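(* Let $A$ be a commutative Noetherian ring with unit, $M$ a finitely generated $A$-module and $l$ a natural number. Then $\operatorname{cmd}_A(M)\le l$ if and only if $M$ has the property $(C_n^l)$ for every $n\in\mathbb{N}$.
   Context: Natural numbers include $0$. The depth of the zero module is $\infty$. If $A$ is a Noetherian local ring and $M\neq 0$ a finitely generated $A$-module, the Cohen-Macaulay defect is $\operatorname{cmd}_A(M)=\dim(M)-\operatorname{depth}_A(M)$; if $M=0$, $\operatorname{cmd}_A(M)=0$. If $A$ is not local, $\operatorname{cmd}_A(M)=\sup\{\operatorname{cmd}_{A_\mathfrak{p}}(M_\mathfrak{p}) : \mathfrak{p}\in\operatorname{Spec}(A)\}$. For natural numbers $n,l$, a finitely generated $A$-module $M$ has the property $(C_n^l)$ if $\operatorname{depth}(M_\mathfrak{p})\ge\min(\dim(M_\mathfrak{p}),n)-l$ for every $\mathfrak{p}\in\operatorname{Spec}(A)$ (depth taken over $A_\mathfrak{p}$; the right-hand side may be negative; the condition holds automatically when $M_\mathfrak{p}=0$). *)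

(* Defs.v *)
From HB Require Import structures.
From mathcomp Require Import all_boot all_order all_algebra generic_quotient.
From mathcomp Require Import boolp classical_sets constructive_ereal.
From mathcomp Require Import ring.

Set Implicit Arguments.
Unset Strict Implicit.
Unset Printing Implicit Defensive.

Import Order.TTheory GRing.Theory Num.Theory.
Local Open Scope classical_set_scope.
Local Open Scope ring_scope.

Local Notation regmod A := [the lmodType A of A^o].

(* Rings are [comPzRingType]s, so that the zero ring is allowed.  The ideals
   and prime ideals of ring_quotient.v require a nonzero ring, whence the
   versions below. *)

Section Modules.
Variables (A : comPzRingType) (M : lmodType A).

Definition submodule (N : set M) : Prop := submod_closed [in N].

Definition span (s : seq M) : set M :=
  [set m | exists c : 'I_(size s) -> A, m = \sum_(i < size s) c i *: s`_i].

Definition fin_gen (N : set M) : Prop := exists s : seq M, N = span s.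

Definition fg_module : Prop := fin_gen [set: M].

Definition zero_module : Prop := forall m : M, m = 0.

(* the submodule (x_1, ..., x_k) M *)
Definition seq_mul (xs : seq A) : set M :=
  [set m | exists f : 'I_(size xs) -> M, m = \sum_(i < size xs) xs`_i *: f i].

(* x_(i+1) is not a zero divisor on M / (x_1, ..., x_i) M, and
   M / (x_1, ..., x_k) M is not zero *)
Definition regular_seq (xs : seq A) : Prop :=
  (forall i : nat, (i < size xs)%N -> forall m : M,
      seq_mul (take i xs) (xs`_i *: m) -> seq_mul (take i xs) m) /\
  seq_mul xs <> [set: M].

End Modules.

Section Ideals.
Variable A : comPzRingType.

Definition ideal (I : set A) : Prop := @submodule A (regmod A) I.

Definition noetherian : Prop :=
  forall I : set A, ideal I -> @fin_gen A (regmod A) I.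

Definition maximal_ideal (m : set A) : Prop :=
  [/\ ideal m, m <> setT &
      forall I : set A, ideal I -> m `<=` I -> I <> setT -> I = m].

Definition local_ring : Prop := exists! m : set A, maximal_ideal m.

(* the maximal ideal when A is local *)
Definition max_ideal : set A := xget setT [set m | maximal_ideal m].

Record spec := Spec {
  prime_set :> set A;
  prime_ideal : ideal prime_set;
  prime_proper : ~ prime_set 1;
  primeM : forall x y : A, prime_set (x * y) -> prime_set x \/ prime_set y }.

End Ideals.

Arguments max_ideal A : clear implicits.

(* The localization M_p is the quotient of M * (A \ p) by the usual relation
   (m, s) ~ (n, t) iff u (t m - s n) = 0 for some u outside p; the ring A_p is
   the localization of A^o. *)
Section Localization.
Variables (A : comPzRingType) (p : spec A).

Definition denom := {s : A | s \notin (p : set A)}.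
Definition den (s : denom) : A := val s.

Lemma denP (s : denom) : ~ prime_set p (den s).
Proof. by have := valP s; rewrite notin_setE. Qed.

Lemma denom1_subproof : (1 : A) \notin (p : set A).
Proof. by rewrite notin_setE; exact: prime_proper. Qed.

Definition denom1 : denom := Sub 1 denom1_subproof.

Lemma denomM_subproof (s t : denom) : den s * den t \notin (p : set A).
Proof. by rewrite notin_setE => /primeM[]; exact: denP. Qed.

Definition denomM (s t : denom) : denom := Sub (den s * den t) (denomM_subproof s t).

Lemma den1 : den denom1 = 1. Proof. by []. Qed.
Lemma denM s t : den (denomM s t) = den s * den t. Proof. by []. Qed.

Section Module.
Variable M : lmodType A.

Definition loc_rel (x y : M * denom) : bool :=
  `[< exists u : denom, den u *: (den y.2 *: x.1 - den x.2 *: y.1) = 0 >].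

Lemma loc_relP x y : reflect
  (exists u : denom, (den u * den y.2) *: x.1 = (den u * den x.2) *: y.1)
  (loc_rel x y).
Proof.
apply: (iffP (asboolP _)) => -[u ux]; exists u.
  by apply/eqP; rewrite -subr_eq0 -!scalerA -scalerBr ux.
by rewrite scalerBr !scalerA ux subrr.
Qed.

Lemma loc_rel_equiv : equiv_class_of loc_rel.
Proof.
split=> [x|x y|y x z].
- by apply/loc_relP; exists denom1.
- by apply/loc_relP/loc_relP => -[u ux]; exists u.
- move=> /loc_relP[u ux] /loc_relP[v vy]; apply/loc_relP.
  exists (denomM (denomM u v) y.2); rewrite !denM.
  have -> : den u * den v * den y.2 * den z.2 =
            den v * den z.2 * (den u * den y.2) by ring.
  rewrite -scalerA ux scalerA.
  have -> : den v * den z.2 * (den u * den x.2) =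
            den u * den x.2 * (den v * den z.2) by ring.
  by rewrite -scalerA vy scalerA; congr (_ *: _); ring.
Qed.

Canonical loc_rel_equivRel := EquivRelPack loc_rel_equiv.
Canonical loc_rel_encModRel := defaultEncModRel loc_rel.

Definition loc : Type := {eq_quot loc_rel}%qT.
HB.instance Definition _ := Choice.on loc.

Definition frac (x : M) (s : denom) : loc := (\pi_({eq_quot loc_rel}) (x, s))%qT.

Lemma fracP x s y t : frac x s = frac y t <->
  exists u : denom, (den u * den t) *: x = (den u * den s) *: y.
Proof.
split=> [/eqP|xy]; last apply/eqP; rewrite eqmodE.
  by move/loc_relP.
exact/loc_relP.
Qed.

Definition num_of (z : loc) : M := (repr (z : {eq_quot loc_rel}%qT)).1.
Definition den_of (z : loc) : denom := (repr (z : {eq_quot loc_rel}%qT)).2.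

Lemma num_denK z : frac (num_of z) (den_of z) = z.
Proof. by rewrite /frac -surjective_pairing reprK. Qed.

Lemma fracW (P : loc -> Prop) : (forall x s, P (frac x s)) -> forall z, P z.
Proof. by move=> PF z; rewrite -(num_denK z). Qed.

Lemma num_den_frac x s : exists u : denom,
  (den u * den s) *: num_of (frac x s) = (den u * den (den_of (frac x s))) *: x.
Proof. exact/fracP/num_denK. Qed.

Definition loc_zero : loc := frac 0 denom1.
Definition loc_opp (z : loc) : loc := frac (- num_of z) (den_of z).
Definition loc_add (z w : loc) : loc :=
  frac (den (den_of w) *: num_of z + den (den_of z) *: num_of w)
       (denomM (den_of z) (den_of w)).

Lemma loc_oppE x s : loc_opp (frac x s) = frac (- x) s.
Proof.
by apply/fracP; have [u ux] := num_den_frac x s; exists u; rewrite !scalerN ux.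
Qed.

Lemma loc_addE x s y t :
  loc_add (frac x s) (frac y t) = frac (den t *: x + den s *: y) (denomM s t).
Proof.
rewrite /loc_add; apply/fracP.
have [u ux] := num_den_frac x s; have [v vy] := num_den_frac y t.
move: (num_of _) (den_of _) ux => x' s' ux.
move: (num_of _) (den_of _) vy => y' t' vy.
exists (denomM u v); rewrite !denM !scalerDr !scalerA; congr (_ + _).
  have -> : den u * den v * (den s * den t) * den t' =
            den v * den t * den t' * (den u * den s) by ring.
  by rewrite -scalerA ux scalerA; congr (_ *: _); ring.
have -> : den u * den v * (den s * den t) * den s' =
          den u * den s * den s' * (den v * den t) by ring.
by rewrite -scalerA vy scalerA; congr (_ *: _); ring.
Qed.

Lemma frac_congr x s y t : den t *: x = den s *: y -> frac x s = frac y t.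
Proof. by move=> xy; apply/fracP; exists denom1; rewrite -!scalerA xy. Qed.

Lemma loc_addA : associative loc_add.
Proof.
elim/fracW => x s; elim/fracW => y t; elim/fracW => z r.
rewrite !loc_addE; apply: frac_congr; rewrite !denM !scalerDr !scalerA addrA.
by congr (_ *: _ + _ *: _ + _ *: _); ring.
Qed.

Lemma loc_addC : commutative loc_add.
Proof.
elim/fracW => x s; elim/fracW => y t.
rewrite !loc_addE; apply: frac_congr; rewrite !denM addrC.
by congr (_ *: _); ring.
Qed.

Lemma loc_add0 : left_id loc_zero loc_add.
Proof.
elim/fracW => x s; rewrite loc_addE; apply: frac_congr.
by rewrite !denM den1 scaler0 add0r scale1r mul1r.
Qed.

Lemma loc_addN : left_inverse loc_zero loc_opp loc_add.
Proof.
elim/fracW => x s; rewrite loc_oppE loc_addE; apply: frac_congr.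
by rewrite scalerN addNr !scaler0.
Qed.

HB.instance Definition _ :=
  GRing.isZmodule.Build loc loc_addA loc_addC loc_add0 loc_addN.

Lemma addfrac x s y t :
  frac x s + frac y t = frac (den t *: x + den s *: y) (denomM s t).
Proof. exact: loc_addE. Qed.

End Module.

Local Notation Ao := (regmod A).

Lemma regscaleE (a : A) (b : Ao) : a *: b = (a : A) * (b : A) :> A.
Proof. by []. Qed.

Definition loc_scale (M : lmodType A) (a : loc Ao) (z : loc M) : loc M :=
  frac ((num_of a : A) *: num_of z) (denomM (den_of a) (den_of z)).

Lemma loc_scaleE (M : lmodType A) (a : A) s (x : M) t :
  loc_scale (frac (a : Ao) s) (frac x t) = frac (a *: x) (denomM s t).
Proof.
rewrite /loc_scale; apply/fracP.
have [u] := @num_den_frac Ao a s; have [v vy] := num_den_frac x t.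
move: (num_of _) (den_of _) => a' s'; rewrite !regscaleE => ua.
move: (num_of _) (den_of _) vy => y' t' vy.
exists (denomM u v); rewrite !denM !scalerA.
have -> : den u * den v * (den s * den t) * (a' : A) =
          den u * den s * (a' : A) * (den v * den t) by ring.
rewrite ua -scalerA vy scalerA; congr (_ *: _); ring.
Qed.

Definition loc_ring : Type := loc Ao.
HB.instance Definition _ := GRing.Zmodule.on loc_ring.

Definition loc_one : loc_ring := frac (1 : Ao) denom1.
Definition loc_mul (a b : loc_ring) : loc_ring := loc_scale a b.

Lemma loc_mulE (a b : A) s t :
  loc_mul (frac (a : Ao) s) (frac (b : Ao) t) = frac (a * b : Ao) (denomM s t).
Proof. exact: loc_scaleE. Qed.

Section LocScale.
Variable M : lmodType A.
Implicit Types (a b : loc_ring) (z w : loc M).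

Lemma loc_scaleA a b z : loc_scale a (loc_scale b z) = loc_scale (loc_mul a b) z.
Proof.
elim/fracW: a => a s; elim/fracW: b => b t; elim/fracW: z => x r.
rewrite loc_mulE (loc_scaleE b) (loc_scaleE a) (loc_scaleE (a * b : A)).
by apply: frac_congr; rewrite !denM !scalerA; congr (_ *: _); ring.
Qed.

Lemma loc_scale1 : left_id loc_one (@loc_scale M).
Proof.
elim/fracW => x s; rewrite /loc_one loc_scaleE; apply: frac_congr.
by rewrite denM den1 scale1r mul1r.
Qed.

Lemma loc_scaleDr : right_distributive (@loc_scale M) +%R.
Proof.
elim/fracW => a s; elim/fracW => x t; elim/fracW => y r.
rewrite addfrac !loc_scaleE addfrac; apply: frac_congr.
by rewrite !denM !scalerDr !scalerA; congr (_ *: _ + _ *: _); ring.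
Qed.

Lemma loc_scaleDl z : {morph (fun a : loc_ring => loc_scale a z) : a b / a + b}.
Proof.
elim/fracW: z => x r; elim/fracW => a s; elim/fracW => b t.
rewrite addfrac !loc_scaleE addfrac; apply: frac_congr.
rewrite !denM !scalerDr !scalerA -!scalerDl !regscaleE; congr (_ *: _); ring.
Qed.

End LocScale.

Lemma loc_mulA : associative loc_mul.
Proof. exact: loc_scaleA. Qed.

Lemma loc_mulC : commutative loc_mul.
Proof.
elim/fracW => a s; elim/fracW => b t; rewrite !loc_mulE.
by apply: frac_congr; rewrite !denM !regscaleE; ring.
Qed.

Lemma loc_mul1 : left_id loc_one loc_mul.
Proof. exact: loc_scale1. Qed.

Lemma loc_mulDl : left_distributive loc_mul +%R.
Proof. by move=> a b c; exact: (@loc_scaleDl Ao c a b). Qed.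

HB.instance Definition _ := GRing.Zmodule_isComPzRing.Build loc_ring
  loc_mulA loc_mulC loc_mul1 loc_mulDl.

HB.instance Definition _ (M : lmodType A) :=
  GRing.Zmodule_isLmodule.Build loc_ring (loc M)
    (@loc_scaleA M) (@loc_scale1 M) (@loc_scaleDr M) (@loc_scaleDl M).

Lemma scalefrac (M : lmodType A) (a : A) s (x : M) t :
  (frac (a : Ao) s : loc_ring) *: frac x t = frac (a *: x) (denomM s t).
Proof. exact: loc_scaleE. Qed.

Lemma mulfrac (a b : A) s t :
  (frac (a : Ao) s : loc_ring) * frac (b : Ao) t = frac (a * b : Ao) (denomM s t).
Proof. exact: loc_mulE. Qed.

End Localization.

Local Notation locmod p M := [the lmodType (loc_ring p) of loc p M].

(* This makes [supremum x0 S] the least upper bound of S as soon as S is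
   nonempty; the default value x0 only serves for the empty set. *)
Lemma supremums_bar_int (S : set (\bar int)) : supremums S !=set0.
Proof.
have [[k kS]|noub] := pselect (exists k : int, ubound S k%:E); last first.
  exists +oo%E; split=> [x _|y yS]; first by rewrite leey.
  case: y yS => [k kS|//|NS]; first by case: noub; exists k.
  by case: noub; exists 0 => x /NS; rewrite leeNy_eq => /eqP->; rewrite leNye.
have [[j Sj]|noint] := pselect (exists j : int, S j%:E); last first.
  exists -oo%E; split=> [x Sx|y _]; last by rewrite leNye.
  case: x Sx => [j Sj|/kS//|//]; by case: noint; exists j.
have ex : exists n : nat, `[< ubound S (j + n%:Z)%:E >].
  have jk : j <= k by have := kS _ Sj; rewrite lee_fin.
  by exists `|k - j|%N; apply/asboolP; rewrite gez0_abs ?subr_ge0// subrKC.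
case: (ex_minnP ex) => n /asboolP nS nmin; exists (j + n%:Z)%:E; split=> // y yS.
case: y yS => [z zS|_|/(_ _ Sj)//]; last by rewrite leey.
have jz : j <= z by have := zS _ Sj; rewrite lee_fin.
have zE : j + `|z - j|%N%:Z = z by rewrite gez0_abs ?subr_ge0// subrKC.
have := nmin `|z - j|%N; rewrite zE => /(_ (introT (asboolP _) zS)) le_n.
by rewrite lee_fin -zE lerD2l lez_nat.
Qed.

Section DimDepth.
Local Open Scope ereal_scope.
Variables (A : comPzRingType) (M : lmodType A).

Definition supp : set (spec A) := [set p | ~ zero_module (loc p M)].

Definition supp_chain (n : nat) (c : nat -> spec A) : Prop :=
  (forall i, (i <= n)%N -> supp (c i)) /\
  (forall i, (i < n)%N -> (c i : set A) `<` c i.+1).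

(* -oo for the zero module *)
Definition krull_dim : \bar int :=
  supremum -oo [set n%:Z%:E | n in [set n : nat | exists c, supp_chain n c]].

(* the depth of M in the ideal I *)
Definition depth_in (I : set A) : \bar int :=
  if `[< zero_module M >] then +oo else
  supremum -oo [set n%:Z%:E | n in [set n : nat | exists xs : seq A,
    [/\ size xs = n, forall x, x \in xs -> I x & regular_seq M xs]]].

(* to be used over local rings only *)
Definition depth : \bar int := depth_in (max_ideal A).

(* For a nonzero finitely generated M over a Noetherian local ring both terms of
   the difference are finite, so that +oo - +oo does not occur. *)
Definition cmd_local : \bar int :=
  if `[< zero_module M >] then 0 else krull_dim - depth.

End DimDepth.

Section Cmd.
Local Open Scope ereal_scope.
Variables (A : comPzRingType) (M : lmodType A).

(* 0 over the zero ring, the supremum being that of the empty set *)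
Definition cmd : \bar int :=
  if `[< local_ring A >] then cmd_local M else
  supremum 0 [set cmd_local (locmod p M) | p in [set: spec A]].

Definition propC (n l : nat) : Prop :=
  forall p : spec A,
    mine (krull_dim (locmod p M)) n%:Z%:E - l%:Z%:E <= depth (locmod p M).

End Cmd.

(* Main.v *)
Require Import Defs.
From mathcomp Require Import all_boot all_order all_algebra.
From mathcomp Require Import boolp classical_sets constructive_ereal.
From mathcomp Require Import ring zify.

(** For a prime q the localized module M_q is studied through saturated
submodules of M, so that a regular sequence on M_q is a regular sequence of
numerators on M modulo torsion prime to q.  The heart is the inequality
cmd(M_p) <= cmd(M_q) for p contained in q.  A regular sequence ys in p that is
maximal on M_q remains regular on M_p, and p is contained in an associated prime
P of M_q / ys M_q.  Since regular sequences can be exchanged, M_q / ys M_q has a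
regular sequence of length depth M_q - |ys|, and each of its elements forces one
more strict step in a chain of primes from P up to q.  Putting this chain on top
of a chain in the support of M_p gives
dim M_p + depth M_q - |ys| <= dim M_q, while |ys| <= depth M_p.
The same exchange bounds the lengths of regular sequences, so neither Ext nor the
finiteness of the dimension is needed. *)

Set Implicit Arguments.
Unset Strict Implicit.
Unset Printing Implicit Defensive.

Import Order.TTheory GRing.Theory Num.Theory.
Local Open Scope classical_set_scope.
Local Open Scope ring_scope.

Local Notation regmod A := [the lmodType A of A^o].
Local Notation span := Defs.span.
Local Notation frac := Defs.frac.

(** * Noetherian modules *)

Section Submodules.
Variables (A : comPzRingType) (M : lmodType A).
Implicit Types (N : set M) (u v w : M) (a : A) (s t : seq M).

Lemma submoduleP N : submodule N <->
  [/\ N 0, forall a u, N u -> N (a *: u) & forall u v, N u -> N v -> N (u + v)].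
Proof.
split=> [[N0 NL]|[N0 NZ ND]].
  have N0' : N 0 by move: N0; rewrite inE.
  have L a u v : N u -> N v -> N (a *: u + v).
    by move=> Nu Nv; have := NL a u v; rewrite !inE; apply.
  split=> // [a u Nu|u v Nu Nv]; first by rewrite -[_ *: _]addr0; apply: L.
  by rewrite -[u]scale1r; apply: L.
split=> [|a u v]; rewrite !inE // => Nu Nv.
by apply: ND => //; apply: NZ.
Qed.

Section Closure.
Variables (N : set M) (subN : submodule N).

Lemma submodule0 : N 0. Proof. by case/submoduleP: subN. Qed.
Lemma submoduleZ a u : N u -> N (a *: u).
Proof. by case/submoduleP: subN => _ + _; apply. Qed.
Lemma submoduleD u v : N u -> N v -> N (u + v).
Proof. by case/submoduleP: subN => _ _; apply. Qed.
Lemma submoduleN u : N u -> N (- u).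
Proof. by move=> Nu; rewrite -scaleN1r; apply: submoduleZ. Qed.
Lemma submoduleB u v : N u -> N v -> N (u - v).
Proof. by move=> Nu Nv; apply/submoduleD/submoduleN. Qed.
Lemma submodule_modl u v : N (u - v) -> N u -> N v.
Proof. by move=> Nuv Nu; rewrite -(subKr u v); apply: submoduleB. Qed.
Lemma mod_sym u v : N (u - v) -> N (v - u).
Proof. by move=> Nuv; rewrite -opprB; apply: submoduleN. Qed.
Lemma mod_trans v u w : N (u - v) -> N (v - w) -> N (u - w).
Proof. by move=> uv vw; rewrite -(subrKA v); apply: submoduleD. Qed.
Lemma modZ a u v : N (u - v) -> N (a *: u - a *: v).
Proof. by rewrite -scalerBr; apply: submoduleZ. Qed.
Lemma modD u v u' v' : N (u - v) -> N (u' - v') -> N ((u + u') - (v + v')).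
Proof. by rewrite opprD addrACA; apply: submoduleD. Qed.
End Closure.

Lemma zero_submodule : submodule [set (0 : M)].
Proof.
apply/submoduleP; split=> //= [a u ->|u v -> ->]; [exact: scaler0|exact: addr0].
Qed.

Lemma span_nil m : span [::] m <-> m = 0 :> M.
Proof.
split=> [[c ->]|->]; first by rewrite big_ord0.
by exists (fun=> 0); rewrite big_ord0.
Qed.

Lemma span_cons x s m :
  span (x :: s) m <-> exists a u, span s u /\ m = a *: x + u.
Proof.
split=> [[c ->]|[a [_ [[c ->] ->]]]].
  exists (c ord0), (\sum_(i < size s) c (lift ord0 i) *: s`_i).
  by split; [exists (c \o lift ord0)|rewrite big_ord_recl].
exists (fun i => if unlift ord0 i is Some j then c j else a).
rewrite big_ord_recl unlift_none; congr (_ + _).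
by apply: eq_bigr => i _; rewrite liftK.
Qed.

Lemma span_cat s t m : span (s ++ t) m <->
  exists u v, [/\ span s u, span t v & m = u + v].
Proof.
elim: s m => [|x s IH] m /=; split.
- by move=> tm; exists 0, m; rewrite add0r; split=> //; apply/span_nil.
- by move=> [_ [v [/span_nil -> tv ->]]]; rewrite add0r.
- move=> /span_cons[a [_ [/IH[u [v [su tv ->]]] ->]]].
  by exists (a *: x + u), v; rewrite addrA; split=> //; apply/span_cons; exists a, u.
- move=> [_ [v [/span_cons[a [u [su ->]]] tv ->]]]; apply/span_cons.
  by exists a, (u + v); rewrite addrA; split=> //; apply/IH; exists u, v.
Qed.

Lemma span_submodule s : submodule (span s).
Proof.
elim: s => [|x s IH]; apply/submoduleP; split.
- exact/span_nil.
- by move=> a u /span_nil ->; apply/span_nil; rewrite scaler0.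
- by move=> u v /span_nil -> /span_nil ->; apply/span_nil; rewrite addr0.
- by apply/span_cons; exists 0, 0; rewrite scale0r addr0; split=> //; apply: submodule0.
- move=> a _ /span_cons[b [u [su ->]]]; apply/span_cons; exists (a * b), (a *: u).
  by rewrite scalerDr scalerA; split=> //; apply: submoduleZ.
- move=> _ _ /span_cons[a [u [su ->]]] /span_cons[b [v [sv ->]]].
  apply/span_cons; exists (a + b), (u + v).
  by rewrite scalerDl addrACA; split=> //; apply: submoduleD.
Qed.

Lemma span_sub s N : submodule N -> (forall x, x \in s -> N x) -> span s `<=` N.
Proof.
move=> subN; elim: s => [_ m /span_nil ->|x s IH sN m /span_cons[a [u [su ->]]]].
  exact: submodule0.
apply: submoduleD => //; first by apply: submoduleZ => //; apply: sN; rewrite inE eqxx.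
by apply: IH su => y ys; apply: sN; rewrite inE ys orbT.
Qed.

Lemma mem_span s x : x \in s -> span s x.
Proof.
elim: s => // y s IH; rewrite inE => /orP[/eqP->|/IH xs]; apply/span_cons.
  by exists 1, 0; rewrite scale1r addr0; split=> //; apply: submodule0; apply: span_submodule.
by exists 0, x; rewrite scale0r add0r.
Qed.

Definition noeth_module := forall N, submodule N -> fin_gen N.

(** Without a maximal member, iterating a choice function gives a strictly increasing sequence in
    [F]. Its union is finitely generated, and the generators all lie in one stage, which then cannot
    grow. *)
Lemma noeth_max (F : set (set M)) N0 : noeth_module ->
    (forall N, F N -> submodule N) -> F N0 ->
  exists N, F N /\ forall N', F N' -> N `<=` N' -> N' `<=` N.
Proof.
move=> noeth Fsub F0; apply: contrapT => noMax.
pose T := {N | F N}.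
have /choice[g gP] : forall X : T, exists Y : T,
    sval X `<=` sval Y /\ ~ (sval Y `<=` sval X).
  move=> [N FN] /=; apply: contrapT => nog; apply: noMax; exists N; split=> //.
  by move=> N' FN' NN'; apply: contrapT => N'N; apply: nog; exists (exist _ N' FN').
pose U n := sval (iter n g (exist _ N0 F0)).
have subU n : submodule (U n) by rewrite /U; case: (iter _ _ _) => N /= /Fsub.
have leU i j : (i <= j)%N -> U i `<=` U j.
  move=> /subnK<-; elim: (j - i)%N => [|k IH] u Ui //=.
  by rewrite addSn /U iterS; apply: (gP _).1; apply: IH.
pose V : set M := [set u | exists n, U n u].
have subV : submodule V.
  apply/submoduleP; split=> [|a u [n Un]|u v [i Ui] [j Uj]].
  - by exists 0%N; apply: submodule0.
  - by exists n; apply: submoduleZ.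
  - exists (maxn i j); apply: submoduleD => //.
      by apply: leU Ui; rewrite leq_maxl.
    by apply: leU Uj; rewrite leq_maxr.
have [s sE] := noeth V subV.
have sV x : x \in s -> V x by rewrite sE; apply: mem_span.
have [n sn] : exists n, forall x, x \in s -> U n x.
  elim: s sV {sE} => [_|x s IH sV]; first by exists 0%N.
  have [|n sn] := IH; first by move=> y ys; apply: sV; rewrite inE ys orbT.
  have [k xk] : V x by apply: sV; rewrite inE eqxx.
  exists (maxn n k) => y; rewrite inE => /orP[/eqP->|/sn].
    by apply: leU xk; rewrite leq_maxr.
  by apply: leU; rewrite leq_maxl.
have [_] := gP (iter n g (exist _ N0 F0)); apply => u Uu.
have : V u by exists n.+1.
by rewrite sE; exact: (span_sub (subU n) sn).
Qed.
End Submodules.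

(** Induction on the generators of the ambient span: the coefficients of [x] occurring in [N] modulo
    [span s] form an ideal, and lifts of its generators to [N], together with generators of the
    intersection of [N] with [span s], generate [N]. *)
Lemma noeth_fg (A : comPzRingType) (M : lmodType A) :
  noetherian A -> fg_module M -> noeth_module M.
Proof.
move=> noethA [s0 s0T].
suff H s (N : set M) : submodule N -> N `<=` span s -> fin_gen N.
  by move=> N subN; apply: (H s0) => //; rewrite -s0T.
elim: s N => [|x s IH] N subN Ns.
  exists [::]; apply/seteqP; split=> // m /span_nil ->; exact: submodule0.
pose I : set A := [set a | exists u, span s u /\ N (a *: x + u)].
have subs := span_submodule s.
have idI : ideal I.
  apply/submoduleP; split=> [|a b [u [su Nu]]|a b [u [su Nu]] [v [sv Nv]]].
  - by exists 0; split; [exact: submodule0|rewrite scale0r addr0; exact: submodule0].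
  - exists (a *: u); split; first exact: submoduleZ.
    by rewrite -[(a *: b) *: x]scalerA -scalerDr; exact: submoduleZ.
  - exists (u + v); split; first exact: submoduleD.
    by rewrite scalerDl addrACA; exact: submoduleD.
have [as_ IE] := noethA I idI.
have asI a : a \in as_ -> I a by rewrite IE; apply: (@mem_span A (regmod A)).
have [ns [nsN nsP]] : exists ns : seq M, span ns `<=` N /\
    forall a, @span A (regmod A) as_ a -> exists v, span ns v /\ span s (v - a *: x).
  elim: as_ asI {IE} => [_|a as_ IHas asI].
    exists [::]; split=> [_ /span_nil ->|a]; first exact: submodule0.
    move=> /(span_nil (M:=regmod A)) ->; exists 0; rewrite scale0r subr0.
    by split; [exact/span_nil|exact: submodule0].
  have [|ns [nsN nsP]] := IHas; first by move=> b bs; apply: asI; rewrite inE bs orbT.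
  have [u [su Nu]] : I a by apply: asI; rewrite inE eqxx.
  exists (a *: x + u :: ns); split.
    by move=> _ /span_cons[b [v [/nsN Nv ->]]]; apply: submoduleD => //; apply: submoduleZ.
  move=> _ /(span_cons (M:=regmod A))[b [c [/nsP[v [sv svc]] ->]]].
  exists (b *: (a *: x + u) + v); split; first by apply/span_cons; exists b, v.
  rewrite scalerDl -[(b *: a) *: x]scalerA scalerDr.
  have -> (X Y v1 Z : M) : X + Y + v1 - (X + Z) = Y + (v1 - Z).
    by rewrite -[X + Y + v1]addrA opprD addrACA subrr add0r addrA.
  by apply: submoduleD => //; apply: submoduleZ.
have [t tE] : fin_gen (N `&` span s).
  apply: IH => [|m []//]; apply/submoduleP; split.
  - by split; exact: submodule0.
  - by move=> a u [Nu su]; split; exact: submoduleZ.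
  - by move=> u v [Nu su] [Nv sv]; split; exact: submoduleD.
exists (ns ++ t); apply/seteqP; split=> m; last first.
  move=> /span_cat[u [v [/nsN Nu tv ->]]]; apply: submoduleD => //.
  by move: tv; rewrite -tE => -[].
move=> Nm; have /span_cons[a [u [su mE]]] := Ns m Nm.
have [v [sv svx]] : exists v, span ns v /\ span s (v - a *: x).
  by apply: nsP; rewrite -IE; exists u; rewrite -mE.
apply/span_cat; exists v, (m - v); rewrite subrKC; split=> //.
rewrite -tE; split; first by apply: submoduleB => //; apply: nsN.
rewrite mE [_ + u]addrC -addrA; apply: submoduleD => //; rewrite -opprB.
exact: submoduleN.
Qed.

(** * Regular sequences relative to a prime *)

Section RegularSequences.
Variables (A : comPzRingType) (M : lmodType A).
Implicit Types (N K : set M) (S I : set A) (x y a : A) (xs ys : seq A).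

(** For [S] the complement of a prime, these are the preimages in [M] of the submodules of the
    localization. *)
Definition saturated S N := submodule N /\ forall s m, S s -> N (s *: m) -> N m.

(** For such [S], the preimage of the localization of [N]; for [N] zero, the kernel of the map from
    [M] to its localization. *)
Definition sat S N : set M := [set m | exists s, S s /\ N (s *: m)].

(* the preimage in M of the submodule N_S + x M_S of the localization M_S *)
Definition ext S N x : set M :=
  [set m | exists s m', S s /\ N (s *: m - x *: m')].

Definition reg N x := forall m, N (x *: m) -> N m.

(* For S = ~` p and N saturated, xs is a regular sequence in I on (M / N)_p;
   S = [set 1] gives regular sequences on M / N itself. *)
Fixpoint rs S I N xs : Prop :=
  if xs is x :: xs' then [/\ I x, reg N x & rs S I (ext S N x) xs']
  else N <> setT.

Definition ann N m : set A := [set a | N (a *: m)].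

Lemma ann_ideal N m : submodule N -> ideal (ann N m).
Proof.
move=> subN; apply/submoduleP; split=> [|a b Nb|a b Na Nb]; rewrite /ann /=.
- by rewrite scale0r; apply: submodule0.
- by rewrite -[(a *: b) *: m]scalerA; apply: submoduleZ.
- by rewrite scalerDl; apply: submoduleD.
Qed.

Lemma idealM I a b : ideal I -> I b -> I (a * b).
Proof. by move=> /submoduleP[_ + _]; apply. Qed.

Lemma idealB I a b : ideal I -> I a -> I b -> I (a - b).
Proof. by move=> /submoduleB; apply. Qed.

Lemma idealD I a b : ideal I -> I a -> I b -> I (a + b).
Proof. by move=> /submoduleP[_ _]; apply. Qed.

Lemma ext_submodule S N x : S 1 -> (forall s t, S s -> S t -> S (s * t)) ->
  submodule N -> submodule (ext S N x).
Proof.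
move=> S1 SM subN; apply/submoduleP.
split=> [|a u [s [u' [Ss Nu]]]|u v [s [u' [Ss Nu]]] [t [v' [St Nv]]]].
- by exists 1, 0; split=> //; rewrite !scaler0 subr0; exact: submodule0.
- exists s, (a *: u'); split=> //; rewrite !scalerA [s * a]mulrC [x * a]mulrC.
  by rewrite -!scalerA; apply: modZ.
- exists (s * t), (t *: u' + s *: v'); split; first exact: SM.
  rewrite !scalerDr; apply: modD => //.
    by rewrite scalerA [s * t]mulrC [x * t]mulrC -!scalerA; apply: modZ.
  by rewrite scalerA [x * s]mulrC -!scalerA; apply: modZ.
Qed.

End RegularSequences.

(** * Nakayama's lemma and permutation of regular sequences at a prime *)

Section Prime.
Variables (A : comPzRingType) (M : lmodType A) (p : spec A).
Implicit Types (N K : set M) (I : set A) (x y a : A) (xs ys : seq A).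
Notation S := (~` (prime_set p)).

Lemma notin_prime1 : S 1. Proof. exact: prime_proper. Qed.
Lemma notin_primeM x y : S x -> S y -> S (x * y).
Proof. by move=> px py /primeM[]. Qed.
Lemma notin_primeB x y : S x -> prime_set p y -> S (x - y).
Proof.
move=> px py pxy; apply: px; rewrite -(subrK y x).
exact: (idealD (prime_ideal p)).
Qed.
Lemma pM x y : prime_set p x -> prime_set p (y * x).
Proof. exact: (idealM y (prime_ideal p)). Qed.

Lemma sat_saturated N : submodule N -> saturated S (sat S N).
Proof.
move=> subN; split.
  apply/submoduleP; split=> [|a u [s [Ss Nu]]|u v [s [Ss Nu]] [t [St Nv]]].
  - by exists 1; split; [exact: notin_prime1|rewrite scaler0; exact: submodule0].
  - exists s; split=> //; rewrite scalerA mulrC -scalerA; exact: submoduleZ.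
  - exists (s * t); split; first exact: notin_primeM.
    rewrite scalerDr; apply: submoduleD => //; last by rewrite -scalerA; apply: submoduleZ.
    by rewrite mulrC -scalerA; apply: submoduleZ.
move=> s m Ss [t [St]]; rewrite scalerA => H; exists (t * s); split=> //.
exact: notin_primeM.
Qed.

Lemma ext_saturated N x : submodule N -> saturated S (ext S N x).
Proof.
move=> subN; split; first exact: ext_submodule notin_prime1 notin_primeM _.
move=> s m Ss [t [m' [St]]]; rewrite scalerA => H; exists (t * s), m'; split=> //.
exact: notin_primeM.
Qed.

Lemma sub_ext N x : N `<=` ext S N x.
Proof.
move=> m Nm; exists 1, 0; split; first exact: notin_prime1.
by rewrite scale1r scaler0 subr0.
Qed.

Lemma ext_scale N x m : submodule N -> ext S N x (x *: m).
Proof.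
move=> subN; exists 1, m; split; first exact: notin_prime1.
by rewrite scale1r subrr; exact: submodule0.
Qed.

(* Nakayama's lemma for the localization at p: a maximal saturated submodule U
   not containing K yields k in K \ U with (s - x a) k in U. *)
Lemma nakayama N K x : noeth_module M -> saturated S N -> prime_set p x ->
    (forall k, K k -> exists s k', [/\ S s, K k' & N (s *: k - x *: k')]) ->
  K `<=` N.
Proof.
move=> noethM pN px KP; apply: contrapT => nKN.
have [U [[[subU satU] NU KU] Umax]] := noeth_max
  (F := [set U | [/\ saturated S U, N `<=` U & ~ (K `<=` U)]]) noethM
  (fun U FU => let: And3 (conj H _) _ _ := FU in H)
  (And3 pN (@subset_refl _ _) nKN).
have [k Kk nUk] : exists2 k, K k & ~ U k.
  apply: contrapT => H; apply: KU => k Kk; apply: contrapT => nUk; apply: H.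
  by exists k.
(* [V] is the saturated submodule generated by [U] and [k]. It is larger than [U], so by maximality
   it contains [K]. *)
pose V := [set v | exists s a, S s /\ U (s *: v - a *: k)].
have pV : saturated S V.
  split.
    apply/submoduleP; split=> [|a u [s [b [Ss Uu]]]|u v [s [b [Ss Uu]]] [t [c [St Uv]]]].
    - exists 1, 0; split; first exact: notin_prime1.
      by rewrite scaler0 scale0r subr0; exact: submodule0.
    - exists s, (a * b); split=> //; rewrite scalerA [s * a]mulrC.
      by rewrite -!scalerA; apply: modZ.
    - exists (s * t), (t * b + s * c); split; first exact: notin_primeM.
      rewrite scalerDr scalerDl; apply: modD => //; rewrite -!scalerA.
        by rewrite scalerA [s * t]mulrC -!scalerA; apply: modZ.
      by apply: modZ.
  move=> s m Ss [t [a [St]]]; rewrite scalerA => H; exists (t * s), a; split=> //.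
  exact: notin_primeM.
have UV : U `<=` V.
  move=> u Uu; exists 1, 0; split; first exact: notin_prime1.
  by rewrite scale1r scale0r subr0.
have Vk : V k by exists 1, 1; split; [exact: notin_prime1|rewrite subrr; exact: submodule0].
have KV : K `<=` V.
  apply: contrapT => nKV; apply/nUk/(Umax V) => //; split=> //.
  exact: subset_trans UV.
have [s [k' [Ss Kk' /NU Uk]]] := KP k Kk.
have [s' [a [Ss' Uk']]] := KV k' Kk'.
apply/nUk/(satU (s' * s - x * a)).
  by apply: notin_primeB; [exact: notin_primeM|rewrite mulrC; exact: pM].
rewrite scalerBl -!scalerA; apply: (mod_trans subU (v := x *: (s' *: k'))).
  by rewrite [x *: _]scalerA mulrC -scalerA; apply: modZ.
exact: modZ.
Qed.

Lemma ext_proper N x : noeth_module M -> saturated S N -> prime_set p x -> N <> setT ->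
  ext S N x <> setT.
Proof.
move=> noethM pN px NT ET; apply: NT; apply/seteqP; split=> // m _.
apply: (nakayama (K := setT) noethM pN px) => // k _.
by have [s [k' [Ss H]]] : ext S N x k by [rewrite ET]; exists s, k'.
Qed.

Lemma rs_proper I N xs : submodule N -> rs S I N xs -> N <> setT.
Proof.
elim: xs N => // x xs IH N subN [_ _ /(IH _ (ext_saturated x subN).1) H] NT; apply: H.
apply/seteqP; split=> // m _; apply: sub_ext; by rewrite NT.
Qed.

(** Both sides are the preimage of the localization of [N + x M + y M]. *)
Lemma extC N x y : saturated S N -> ext S (ext S N x) y = ext S (ext S N y) x.
Proof.
suff H x' y' : saturated S N -> ext S (ext S N x') y' `<=` ext S (ext S N y') x'.
  by move=> pN; apply/seteqP; split; apply: H.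
move=> [subN satN] m [s [m1 [Ss [t [m2 [St H]]]]]].
exists (t * s), m2; split; first exact: notin_primeM.
exists 1, (t *: m1); split; first exact: notin_prime1.
by move: H; rewrite scale1r scalerBr !scalerA [y' * t]mulrC addrAC.
Qed.

(** Let [K] be the elements killed by [y] modulo [N]. Regularity of [y] modulo [x] and of [x] gives
    [K = x K] up to denominators, so Nakayama puts [K] inside [N]. The second claim follows by
    cancelling [x]. *)
Lemma reg_swap N x y : noeth_module M -> saturated S N -> prime_set p x ->
  reg N x -> reg (ext S N x) y -> reg N y /\ reg (ext S N y) x.
Proof.
move=> noethM pN px rx ry; have [subN satN] := pN; split=> m.
  move: m; apply: (nakayama (K := [set m | N (y *: m)]) noethM pN px) => k Nyk.
  have [s [k' [Ss Nk]]] := ry k (sub_ext x (Nyk : N _)).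
  exists s, k'; split=> //; apply: rx.
  rewrite scalerA mulrC -scalerA.
  apply: (submodule_modl subN (modZ subN y Nk)).
  by rewrite scalerA mulrC -scalerA; apply: submoduleZ.
move=> [s [m' [Ss H]]].
have [t [m'' [St H']]] : ext S N x m'.
  apply: ry; exists 1, (s *: m); split; first exact: notin_prime1.
  by rewrite scale1r [x *: _]scalerA mulrC -scalerA; apply: mod_sym.
exists (t * s), m''; split; first exact: notin_primeM; apply: rx.
rewrite scalerBr; apply: (mod_trans subN (v := (y * t) *: m')).
  have -> : x *: ((t * s) *: m) = t *: (s *: (x *: m)).
    by rewrite !scalerA; congr (_ *: _); ring.
  by rewrite [y * t]mulrC -[_ *: m']scalerA; apply: modZ.
by rewrite -scalerA [x *: _]scalerA [x * y]mulrC -scalerA; apply: modZ.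
Qed.

(** As [y] kills [z] modulo [x], one can write [y z = x w] modulo [N], up to a denominator, and [w]
    is the new element. This is the elementary form of identifying both socles with the same Ext^1
    of the residue field. *)
Lemma socle_exchange N x y : saturated S N ->
    prime_set p x -> prime_set p y -> reg N x -> reg N y ->
  (exists2 z, ~ ext S N x z & forall a, prime_set p a -> ext S N x (a *: z)) ->
  exists2 w, ~ ext S N y w & forall a, prime_set p a -> ext S N y (a *: w).
Proof.
move=> [subN satN] px py rx ry [z nz az].
have [s [w [Ss H]]] := az y py; exists w.
  move=> [t [w' [St H']]]; apply: nz.
  exists (t * s), w'; split; first exact: notin_primeM.
  apply: ry; rewrite scalerBr; apply: (mod_trans subN (v := x *: (t *: w))).
    have -> : y *: ((t * s) *: z) = t *: (s *: (y *: z)).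
      by rewrite !scalerA; congr (_ *: _); ring.
    by rewrite [x *: _]scalerA [x * t]mulrC -scalerA; apply: modZ.
  by rewrite [y *: _]scalerA [y * x]mulrC -scalerA; apply: modZ.
move=> a pa; have [t [u [St H']]] := az a pa.
exists t, (s *: u); split=> //; apply: rx; rewrite scalerBr.
apply: (mod_trans subN (v := (t * a * s * y) *: z)).
  have -> : x *: (t *: (a *: w)) = (t * a) *: (x *: w).
    by rewrite !scalerA; congr (_ *: _); ring.
  by rewrite -[_ *: z]scalerA -mulrA -!scalerA; do 2!apply: modZ => //; apply: mod_sym.
have -> : (t * a * s * y) *: z = (y * s) *: (t *: (a *: z)).
  by rewrite !scalerA; congr (_ *: _); ring.
have -> : x *: (y *: (s *: u)) = (y * s) *: (x *: u).
  by rewrite !scalerA; congr (_ *: _); ring.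
exact: modZ.
Qed.
End Prime.

(** * Associated primes and prime avoidance *)

Section Associated.
Variables (A : comPzRingType).
Hypothesis noethA : noeth_module (regmod A).

(* P is a maximal one among the annihilators of nonzero elements of M / N. *)
Lemma ass_above (M : lmodType A) (N : set M) u : submodule N -> ~ N u ->
  exists z (P : spec A), [/\ ~ N z, (P : set A) = ann N z, ann N u `<=` P &
    forall w, ~ N w -> (P : set A) `<=` ann N w -> ann N w `<=` P].
Proof.
move=> subN nNu.
have [||I [[z [nNz IE uI]] Imax]] := @noeth_max _ (regmod A)
  [set I | exists z, [/\ ~ N z, I = ann N z & ann N u `<=` I]] (ann N u) noethA.
- by move=> I [z [_ -> _]]; apply: ann_ideal.
- by exists u; split=> //; apply: subset_refl.
have prI x y : I (x * y) -> I x \/ I y.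
  rewrite IE => Nxy; have [Ny|nNy] := pselect (N (y *: z)); first by right.
  left; rewrite -IE; apply: (Imax (ann N (y *: z))).
  - exists (y *: z); split=> // a /uI; rewrite IE /ann /= => Naz.
    by rewrite scalerA mulrC -scalerA; apply: submoduleZ.
  - by move=> a; rewrite IE /ann /= scalerA mulrC -scalerA; apply: submoduleZ.
  - by rewrite /ann /= scalerA.
have idI : ideal I by rewrite IE; apply: ann_ideal.
have I1 : ~ I 1 by rewrite IE /ann /= scale1r.
exists z, (@Spec A I idI I1 prI); split=> //= w nNw Iw; apply: Imax => //.
by exists w; split=> //; apply: subset_trans Iw.
Qed.

(** The list is chosen with the span [W] of its witnesses maximal. For a zero divisor [a], a maximal
    annihilator [P] containing [a] then has its witness [z] in [W]. If no listed prime contained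
    [a], none would lie in [P], and some [b] outside [P] would kill [W], hence [z]. *)
Lemma ass_finite (M : lmodType A) (N : set M) : noeth_module M -> submodule N ->
  exists Ps : seq (spec A),
    (forall P, List.In P Ps -> exists2 z, ~ N z & (P : set A) = ann N z) /\
    (forall a, ~ reg N a -> exists P : spec A, List.In P Ps /\ prime_set P a).
Proof.
move=> noethM subN.
pose good (Ps : seq (spec A * M)) := forall Pz, List.In Pz Ps ->
  [/\ ~ N Pz.2, (Pz.1 : set A) = ann N Pz.2 &
  forall w, ~ N w -> (Pz.1 : set A) `<=` ann N w -> ann N w `<=` Pz.1].
have [W [[Ps [gPs WE]] Wmax]] := @noeth_max _ M
  [set W | exists Ps, good Ps /\ W = span (map snd Ps)] (span [::]) noethM
  (fun W '(ex_intro Ps (conj _ e)) => let: erefl := esym e in span_submodule _)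
  (ex_intro _ [::] (conj (fun _ => False_ind _) erefl)).
exists (map fst Ps); split.
  by move=> P /List.in_map_iff[Pz [<- /gPs[? ? _]]]; exists Pz.2.
move=> a nra; have [u Nau nNu] : exists2 u, N (a *: u) & ~ N u.
  apply: contrapT => H; apply: nra => m Nam; apply: contrapT => nNm; apply: H.
  by exists m.
have [z [P [nNz PE uP Pmax]]] := ass_above subN nNu.
have Wz : W z.
  apply: (Wmax (span (map snd ((P, z) :: Ps)))).
  - exists ((P, z) :: Ps); split=> // Qw /= [<-|/gPs//]; first by split.
  - move=> m; rewrite WE => Wm; apply/span_cons; exists 0, m.
    by rewrite scale0r add0r.
  - by apply: mem_span; rewrite inE eqxx.
suff [Q [QPs Qa]] : exists Q : spec A * M, List.In Q Ps /\ prime_set Q.1 a.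
  by exists Q.1; split=> //; apply/List.in_map_iff; exists Q.
apply: contrapT => noQ.
(* [b] is a product with one factor [c] in [Q] but not in [P] for each listed [Q]. Such a [c]
   exists: if [Q] lay in [P], maximality of [Q] would force [P] into [Q], and [a] would lie in
   [Q]. *)
have [b [nPb bW]] : exists b, ~ prime_set P b /\ forall w, W w -> N (b *: w).
  have Pa : prime_set P a by apply: uP.
  rewrite WE; elim: {W Wmax WE Wz Pmax} Ps gPs noQ => [|Qw Ps IH] gPs noQ.
    exists 1; split; first exact: prime_proper.
    by move=> _ /span_nil ->; rewrite scaler0; apply: submodule0.
  have [||b [nPb bW]] := IH.
  - by move=> Q QPs; apply: gPs; right.
  - by move=> [Q [QPs Qa]]; apply: noQ; exists Q; split=> //; right.
  have [nNw QE Qmax] := gPs Qw (or_introl erefl).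
  have [c Qc nPc] : exists2 c, prime_set Qw.1 c & ~ prime_set P c.
    apply: contrapT => H.
    have QP : (Qw.1 : set A) `<=` P.
      by move=> c Qc; apply: contrapT => nPc; apply: H; exists c.
    apply: noQ; exists Qw; split; first by left.
    by apply: (Qmax z nNz); rewrite -PE.
  exists (c * b); split; first by move=> /primeM[].
  move=> _ /span_cons[d [v [/bW Nbv ->]]]; rewrite scalerDr; apply: submoduleD => //.
    rewrite scalerA [c * b]mulrC mulrAC -scalerA; apply: submoduleZ => //.
    by move: Qc; rewrite QE.
  by rewrite -scalerA; apply: submoduleZ.
by apply: nPb; rewrite PE; apply: bW.
Qed.

Lemma prime_avoidance (I : set A) (Ps : seq (spec A)) : ideal I ->
    (forall P, List.In P Ps -> exists2 a, I a & ~ prime_set P a) ->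
  exists2 a, I a & forall P, List.In P Ps -> ~ prime_set P a.
Proof.
move=> idI; have [n] := ubnP (size Ps); elim: n Ps => // n IH [|P Ps] /= szP IP.
  by exists 0 => //; apply: (submodule0 idI).
have [[Q [QPs QP]]|noQ] := pselect (exists Q : spec A,
    List.In Q Ps /\ (Q : set A) `<=` P).
  have [Ps1 [Ps2 PsE]] := List.in_split _ _ QPs.
  have inE' R : List.In R (P :: Ps1 ++ Ps2) \/ R = Q <-> List.In R (P :: Ps).
    rewrite PsE /= !List.in_app_iff /=; split; first by case=> [[|[]]|->]; auto.
    by case=> [|[|[]]]; auto.
  have [||a Ia aP] := IH (P :: Ps1 ++ Ps2).
  - by move: szP; rewrite PsE /= !size_cat /= addnS.
  - by move=> R RP; apply: IP; apply/inE'; left.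
  exists a => // R /inE'[/aP//|-> /QP].
  by apply: aP; left.
have [||a Ia aP] := IH Ps; first by [].
  by move=> R RP; apply: IP; right.
have [Pa|nPa] := pselect (prime_set P a); last first.
  by exists a => // R [<-|/aP].
(* [e] is an element of [I] outside [P] times one element of [Q] outside [P] for each [Q] in
   [Ps]. *)
have [e [Ie nPe eP]] : exists e, [/\ I e, ~ prime_set P e &
    forall Q, List.In Q Ps -> prime_set Q e].
  have [e0 Ie0 nPe0] := IP P (or_introl erefl).
  elim: Ps noQ {IH szP IP aP} => [|Q Ps IHPs] noQ; first by exists e0; split.
  have [|e [Ie nPe eP]] := IHPs.
    by move=> [R [RPs RP]]; apply: noQ; exists R; split=> //; right.
  have [c Qc nPc] : exists2 c, prime_set Q c & ~ prime_set P c.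
    apply: contrapT => H; apply: noQ; exists Q; split; first by left.
    by move=> c Qc; apply: contrapT => nPc; apply: H; exists c.
  exists (c * e); split; first exact: idealM.
    by move=> /primeM[].
  move=> R [<-|/eP Re]; last exact: (idealM _ (prime_ideal R)).
  by rewrite mulrC; apply: (idealM _ (prime_ideal Q)).
exists (a + e); first exact: idealD.
move=> R [<-|RPs] Rae.
  by apply: nPe; have := idealB (prime_ideal P) Rae Pa; rewrite addrAC subrr add0r.
apply: (aP R RPs); have := idealB (prime_ideal R) Rae (eP R RPs).
by rewrite addrK.
Qed.

(** The zero divisors of both quotients are covered by finitely many associated primes. None
    contains [I], as its witness would be killed by [I]; prime avoidance applies to both lists at
    once. *)
Lemma common_reg (M : lmodType A) (I : set A) (N1 N2 : set M) :
    noeth_module M -> ideal I -> submodule N1 -> submodule N2 ->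
    (forall z, (forall a, I a -> N1 (a *: z)) -> N1 z) ->
    (forall z, (forall a, I a -> N2 (a *: z)) -> N2 z) ->
  exists a, [/\ I a, reg N1 a & reg N2 a].
Proof.
move=> noethM idI sub1 sub2 H1 H2.
have [Ps1 [P1 Z1]] := ass_finite noethM sub1.
have [Ps2 [P2 Z2]] := ass_finite noethM sub2.
have [|a Ia aP] := @prime_avoidance I (Ps1 ++ Ps2) idI; last first.
  exists a; split=> //; apply: contrapT.
    by move=> /Z1[P [PP Pa]]; apply: (aP P) => //; apply/List.in_app_iff; left.
  by move=> /Z2[P [PP Pa]]; apply: (aP P) => //; apply/List.in_app_iff; right.
move=> P PP; apply: contrapT => H.
have IP : I `<=` P by move=> a Ia; apply: contrapT => nPa; apply: H; exists a.
move: PP => /List.in_app_iff[/P1[z nz PE]|/P2[z nz PE]]; apply: nz.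
  by apply: H1 => a /IP; rewrite PE.
by apply: H2 => a /IP; rewrite PE.
Qed.
End Associated.

(** * Exchange of regular sequences and chains of primes *)

Section Exchange.
Variables (A : comPzRingType) (M : lmodType A).
Hypotheses (noethA : noeth_module (regmod A)) (noethM : noeth_module M).
Implicit Types (N : set M) (x y a : A) (xs ys : seq A) (p q P : spec A).
Local Notation cp p := (~` (prime_set p)).

Lemma rs_sub S (I J : set A) N xs : I `<=` J -> rs S I N xs -> rs S J N xs.
Proof. by move=> IJ; elim: xs N => //= x xs IH N [/IJ Jx rx /IH]. Qed.

Lemma exts_saturated p N xs : saturated (cp p) N ->
  saturated (cp p) (foldl (ext (cp p)) N xs).
Proof. by elim: xs N => //= x xs IH N [subN _]; apply/IH/ext_saturated. Qed.

Lemma exts_proper p (I : set A) N xs :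
  rs (cp p) I N xs -> foldl (ext (cp p)) N xs <> setT.
Proof. by elim: xs N => //= x xs IH N [_ _ /IH]. Qed.

Lemma rs_rcons p (I : set A) N xs y : I `<=` p -> saturated (cp p) N -> I y ->
    rs (cp p) I N xs -> reg (foldl (ext (cp p)) N xs) y ->
  rs (cp p) I N (rcons xs y).
Proof.
move=> Ip + Iy; elim: xs N => [|x xs IH] N pN /= => [NT ry|[Ix rx xs_rs] ry].
  by split=> //; apply: ext_proper => //; apply: Ip.
by split=> //; apply: IH => //; apply/ext_saturated/pN.1.
Qed.

(* Some z in p is regular modulo both the head of xs and x: it exists because
   neither quotient has a nonzero element killed by p (socle_exchange).  Both
   pairs (head, z) and (x, z) can then be swapped, and the induction hypothesis
   is used modulo z. *)
Lemma rs_exchange p N x xs n : saturated (cp p) N -> prime_set p x -> reg N x ->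
    rs (cp p) p N xs -> size xs = n.+1 ->
  exists ys, rs (cp p) p (ext (cp p) N x) ys /\ size ys = n.
Proof.
elim: n N x xs => [|n IH] N x xs pN px rx rxs sz.
  exists [::]; split=> //; apply: ext_proper => //.
  exact: rs_proper pN.1 rxs.
case: xs rxs sz => // a1 [|a2 xs] //= [pa1 ra1 rxs] [sz].
have rs_a2 := rxs.
case: rxs => pa2 ra2 _.
have [subN satN] := pN.
have subE y := (@ext_saturated _ _ p N y subN).1.
have [z [pz rz1 rzx]] : exists z,
    [/\ prime_set p z, reg (ext (cp p) N a1) z & reg (ext (cp p) N x) z].
  apply: common_reg => //; first exact: prime_ideal.
    (* An element killed by [p] is killed by [a2], which is regular modulo [a1]. *)
    by move=> z H; apply/ra2/H.
  move=> z H; apply: contrapT => nz.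
  have [|w nw H'] := @socle_exchange A M p N x a1 pN px pa1 rx ra1.
    by exists z.
  by apply/nw/ra2/H'.
have [ys [rys szys]] :=
  IH _ z (a2 :: xs) (ext_saturated p a1 subN) pz rz1 rs_a2 (congr1 S sz).
have [rz ra1z] := reg_swap noethM pN pa1 ra1 rz1.
have [_ rxz] := reg_swap noethM pN px rx rzx.
have [||ws [rws szws]] := IH _ x (a1 :: ys) (ext_saturated p z subN) px rxz.
- by split=> //; rewrite extC.
- by rewrite /= szys.
by exists (z :: ws); rewrite /= szws; split=> //; split=> //; rewrite extC.
Qed.

(** Passing to the quotient by each entry of [ys] costs one entry of the other sequence, by
    [rs_exchange]. *)
Lemma rs_drop p N ys xs k : saturated (cp p) N -> rs (cp p) p N ys ->
    rs (cp p) p N xs -> size xs = (size ys + k)%N ->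
  exists zs, rs (cp p) p (foldl (ext (cp p)) N ys) zs /\ size zs = k.
Proof.
elim: ys N xs => [|y ys IH] N xs pN /=; first by move=> _ rxs sz; exists xs.
move=> [py ry rys] rxs sz.
have [ws [rws szws]] := rs_exchange pN py ry rxs sz.
by apply: IH rys rws szws; apply: ext_saturated; exact: pN.1.
Qed.

Definition pchain n (c : nat -> spec A) :=
  forall i, (i < n)%N -> (c i : set A) `<` c i.+1.

Lemma ass_sub q N P z : saturated (cp q) N -> ~ N z -> (P : set A) = ann N z ->
  (P : set A) `<=` q.
Proof.
move=> [_ satN] nNz PE a; rewrite PE => Na; apply: contrapT => qa.
by apply: nNz; apply: satN Na.
Qed.

(* If x is regular on M / N and P kills a nonzero element of it, then by
   Nakayama P kills a nonzero element of M / (N + x M), so that an associated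
   prime of the latter contains P and x, while x is not in P. *)
Lemma ass_chain q N xs P z : saturated (cp q) N -> ~ N z -> (P : set A) = ann N z ->
    rs (cp q) q N xs ->
  exists c, [/\ c 0%N = P, pchain (size xs) c &
    forall i, (i <= size xs)%N -> (c i : set A) `<=` q].
Proof.
elim: xs N P z => [|x xs IH] N P z pN nNz PE /=.
  by move=> _; exists (fun=> P); split=> // i _; apply: ass_sub PE.
move=> [qx rx rxs]; have [subN satN] := pN.
have pE := ext_saturated q x subN.
have [u Pu nEu] : exists2 u, (forall a, prime_set P a -> N (a *: u)) & ~ ext (cp q) N x u.
  apply: contrapT => H; apply: nNz.
  apply: (nakayama (K := [set u | forall a, prime_set P a -> N (a *: u)])
    noethM pN qx); last first.
    by move=> a /=; rewrite PE.
  move=> u Pu.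
  have [s [u' [Ss Nu]]] : ext (cp q) N x u.
    by apply: contrapT => nEu; apply: H; exists u.
  exists s, u'; split=> // a /Pu Nau; apply: rx.
  rewrite scalerA mulrC -scalerA; apply: (submodule_modl subN (modZ subN a Nu)).
  by rewrite scalerA mulrC -scalerA; apply: submoduleZ.
have [z' [P' [nz' P'E uP' _]]] := ass_above noethA pE.1 nEu.
have [c [c0 cc cq]] := IH _ P' z' pE nz' P'E rxs.
have PP' : (P : set A) `<=` P'.
  by move=> a /Pu Nau; apply: uP'; apply: sub_ext.
exists (fun i => if i is j.+1 then c j else P); split=> //; last first.
  case=> [_|i /cq//]; exact: ass_sub PE.
case=> [_|i]; last exact: cc.
rewrite c0; split=> // P'P.
have : prime_set P x by apply/P'P/uP'/ext_scale.
by rewrite PE => /rx.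
Qed.

(** Elements outside [q] are outside [p], so localizing at [q] and then at [p] is localizing at
    [p]. *)
Lemma sat_ext p q N y : (p : set A) `<=` q -> saturated (cp q) N ->
  ext (cp p) (sat (cp p) N) y = sat (cp p) (ext (cp q) N y).
Proof.
move=> pq [subN satN]; apply/seteqP; split=> m.
  move=> [s [m' [Ss [t [St]]]]]; rewrite scalerBr !scalerA => H.
  exists (t * s); split; first exact: notin_primeM.
  exists 1, (t *: m'); split; first exact: notin_prime1.
  by rewrite scale1r [y *: _]scalerA [y * t]mulrC.
move=> [s [Ss [t [m' [St]]]]]; rewrite scalerA => H.
exists (t * s), m'; split; first by apply: notin_primeM => // /pq.
by exists 1; rewrite scale1r; split=> //; exact: notin_prime1.
Qed.

(** Regularity survives further localization. Properness is assumed at the start and is kept by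
    Nakayama at [p], since the entries lie in [p]. *)
Lemma rs_sat p q N ys : (p : set A) `<=` q -> saturated (cp q) N ->
    rs (cp q) p N ys -> sat (cp p) N <> setT ->
  rs (cp p) p (sat (cp p) N) ys.
Proof.
move=> pq; elim: ys N => //= y ys IH N pN [py ry rys] NT; have [subN _] := pN.
split=> // [m [s [Ss]]|].
  by rewrite scalerA mulrC -scalerA => /ry Nm; exists s.
rewrite (sat_ext _ pq) //; apply: IH => //; first exact: ext_saturated.
by rewrite -(sat_ext _ pq) //; apply: ext_proper => //; apply: sat_saturated.
Qed.

(** Take [U] maximal among the preimages of [N + ys M]. A further regular [y] in [p] could not
    enlarge [U], so [y M] would lie in [U], and regularity would make [U] all of [M]. *)
Lemma rs_maximal p q N : (p : set A) `<=` q -> saturated (cp q) N -> N <> setT ->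
  exists ys, rs (cp q) p N ys /\
    forall y, prime_set p y -> ~ reg (foldl (ext (cp q)) N ys) y.
Proof.
move=> pq pN NT.
have [||U [[ys [rys UE]] Umax]] := noeth_max
  (F := [set U | exists ys, rs (cp q) p N ys /\ U = foldl (ext (cp q)) N ys])
  (N0 := N) noethM.
- by move=> U [ys [_ ->]]; apply: (exts_saturated _ pN).1.
- by exists [::].
exists ys; split=> // y py; rewrite -UE => ry.
have [subU _] : saturated (cp q) U by rewrite UE; apply: exts_saturated.
have EU : ext (cp q) U y `<=` U.
  apply: Umax; last exact: sub_ext.
  exists (rcons ys y); rewrite foldl_rcons -UE; split=> //.
  by apply: rs_rcons => //; rewrite -UE.
apply: (exts_proper rys); rewrite -UE; apply/seteqP; split=> // m _.
exact/ry/EU/ext_scale.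
Qed.

(** Used twice: for [p = q] no strict step is possible, so [size ys] bounds all regular sequences at
    [q]; for [p] inside [q] the chain is stacked on one ending inside [p]. *)
Lemma localized_depth p q : (p : set A) `<=` q ->
    sat (cp p) [set (0 : M)] <> setT ->
  exists ys, rs (cp p) p (sat (cp p) [set (0 : M)]) ys /\
    forall xs, rs (cp q) q (sat (cp q) [set (0 : M)]) xs ->
    exists c : nat -> spec A, [/\ (p : set A) `<=` c 0%N, pchain (size xs - size ys) c &
      forall i, (i <= size xs - size ys)%N -> (c i : set A) `<=` q].
Proof.
move=> pq NT; set N := sat (cp q) [set 0].
have sub00 := zero_submodule M.
have pN : saturated (cp q) N by apply: sat_saturated.
have Np : N `<=` sat (cp p) [set 0].
  by move=> m [s [Ss Nm]]; exists s; split=> // /pq.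
have NpE : sat (cp p) N = sat (cp p) [set 0].
  apply/seteqP; split=> m [s [Ss H]]; last first.
    by exists s; rewrite H; split=> //; apply: (submodule0 pN.1).
  by apply: ((sat_saturated p sub00).2 s) => //; apply: Np.
have [ys [rys ysmax]] : exists ys, rs (cp q) p N ys /\
    forall y, prime_set p y -> ~ reg (foldl (ext (cp q)) N ys) y.
  apply: rs_maximal => // NT'; apply: NT; apply/seteqP; split=> // m _.
  by apply: Np; rewrite NT'.
exists ys; split; first by rewrite -NpE; apply: rs_sat rys _ => //; rewrite NpE.
set N' := foldl _ N ys in ysmax.
have pN' : saturated (cp q) N' by apply: exts_saturated.
(* Otherwise [common_reg], with both submodules equal to [N'], would extend [ys] by an element of
   [p]. *)
have [u nu pu] : exists2 u, ~ N' u & forall a, prime_set p a -> N' (a *: u).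
  apply: contrapT => H.
  have H' z : (forall a, prime_set p a -> N' (a *: z)) -> N' z.
    by move=> pz; apply: contrapT => nz; apply: H; exists z.
  have [a [pa ra _]] := common_reg noethA noethM (prime_ideal p) pN'.1 pN'.1 H' H'.
  exact: ysmax pa ra.
have [z [P [nz PE uP _]]] := ass_above noethA pN'.1 nu.
have pP : (p : set A) `<=` P by move=> a pa; apply/uP/pu.
(* The difference of lengths is truncated: when [ys] is longer than [xs], a constant chain at [P]
   suffices. *)
move=> xs rxs; have [le|lt] := leqP (size ys) (size xs).
  have [||zs [rzs <-]] := @rs_drop q N ys xs (size xs - size ys) pN _ rxs.
  - exact: rs_sub rys.
  - by rewrite subnKC.
  by have [c [c0 cc cq]] := ass_chain pN' nz PE rzs; exists c; rewrite c0.
exists (fun=> P); split=> //; first by move=> i; rewrite (eqP (ltnW lt)).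
by move=> i _; apply: ass_sub PE.
Qed.
End Exchange.

(** * Comparison with the localized module *)

Section PlainRegularSequences.
Variables (A : comPzRingType) (M : lmodType A).
Implicit Types (xs ys : seq A) (I : set A).

Lemma seq_mulP xs (m : M) : seq_mul xs m <->
  exists f : nat -> M, m = \sum_(i < size xs) xs`_i *: f i.
Proof.
split=> [[f ->]|[f ->]]; last by exists (fun i => f i).
exists (fun i => oapp f 0 (insub i)); apply: eq_bigr => i _.
by rewrite valK.
Qed.

Lemma seq_mul_nil : @seq_mul A M [::] = [set 0].
Proof.
apply/seteqP; split=> m /=; first by move=> [f ->]; rewrite big_ord0.
by move=> ->; exists (fun=> 0); rewrite big_ord0.
Qed.

Lemma seq_mul_rcons xs x :
  @seq_mul A M (rcons xs x) = ext [set 1] (seq_mul xs) x.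
Proof.
have sumE (f : nat -> M) :
    \sum_(i < size (rcons xs x)) (rcons xs x)`_i *: f i =
    \sum_(i < size xs) xs`_i *: f i + x *: f (size xs).
  rewrite size_rcons big_ord_recr /= nth_rcons ltnn eqxx; congr (_ + _).
  by apply: eq_bigr => i _; rewrite nth_rcons ltn_ord.
apply/seteqP; split=> m.
  move=> /seq_mulP[f]; rewrite (sumE f) => ->; exists 1, (f (size xs)).
  by split=> //; rewrite scale1r addrK; apply/seq_mulP; exists f.
move=> [_ [m' [-> /seq_mulP[f]]]]; rewrite scale1r => /eqP.
rewrite subr_eq => /eqP ->; apply/seq_mulP.
pose g i := if (i < size xs)%N then f i else m'.
exists g; rewrite (sumE g) /g ltnn.
by congr (_ + _); apply: eq_bigr => i _; rewrite ltn_ord.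
Qed.

Lemma regular_seqP I xs : rs [set 1] I [set (0 : M)] xs <->
  (forall x, x \in xs -> I x) /\ regular_seq M xs.
Proof.
rewrite -seq_mul_nil.
(* The recursion of [rs] changes the base submodule, so the induction carries the prefix already
   consumed. *)
suff H pre : rs [set 1] I (@seq_mul A M pre) xs <-> (forall x, x \in xs -> I x) /\
    ((forall i, (i < size xs)%N -> reg (@seq_mul A M (pre ++ take i xs)) xs`_i) /\
    @seq_mul A M (pre ++ xs) <> setT) by exact: H.
elim: xs pre => [|x xs IH] pre /=.
  rewrite cats0; split=> [H|[_ [_]] //]; split=> //; split=> //.
rewrite -seq_mul_rcons; split.
  move=> [Ix rx /IH[xsI [xsr]]]; rewrite cat_rcons => xsT; split.
    by move=> y; rewrite inE => /orP[/eqP->|/xsI].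
  split=> // -[_|i] /=; first by rewrite cats0.
  by move=> /xsr; rewrite cat_rcons.
move=> [xsI [xsr xsT]]; split.
- by apply: xsI; rewrite inE eqxx.
- by have := xsr 0%N erefl; rewrite /= cats0.
apply/IH; rewrite cat_rcons; split.
  by move=> y yxs; apply: xsI; rewrite inE yxs orbT.
by split=> // i ilt; have := xsr i.+1 ilt; rewrite /= cat_rcons.
Qed.

End PlainRegularSequences.

(** * The maximal ideal of a local ring *)

Section LocalRings.
Variable R : comPzRingType.

Lemma max_idealE (I : set R) : ideal I -> ~ I 1 ->
    (forall x, ~ I x -> exists y, y * x = 1) ->
  local_ring R /\ max_ideal R = I.
Proof.
move=> idI I1 unitP.
have proper (J : set R) : ideal J -> J <> setT -> J `<=` I.
  move=> idJ JT x Jx; apply: contrapT => /unitP[y yx1]; apply: JT.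
  apply/seteqP; split=> // z _; rewrite -[z]mulr1 -yx1.
  by rewrite mulrA; apply: (idealM _ idJ).
have maxI : maximal_ideal I.
  split=> //; first by move=> IT; apply: I1; rewrite IT.
  by move=> J idJ IJ JT; apply/seteqP; split=> //; apply: proper.
have uniqI J : maximal_ideal J -> J = I.
  move=> [idJ JT Jmax]; apply/esym/Jmax => //; first exact: proper.
  by move=> IT; apply: I1; rewrite IT.
split; first by exists I; split=> // J /uniqI.
exact: xget_unique.
Qed.

(** A nonunit generates a proper ideal. The Noetherian condition places it inside a maximal ideal,
    and there is only one. *)
Lemma local_max_ideal : noeth_module (regmod R) -> local_ring R ->
  [/\ ideal (max_ideal R), ~ max_ideal R 1 &
    forall x, ~ max_ideal R x -> exists y, y * x = 1].
Proof.
move=> noethR [I [maxI uniqI]].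
have -> : max_ideal R = I by apply: xget_unique => // J /uniqI.
have [idI IT _] := maxI; split=> //.
  move=> I1; apply: IT; apply/seteqP; split=> // x _.
  by rewrite -[x]mulr1; apply: (idealM _ idI).
move=> x nIx; apply: contrapT => nunit; apply: nIx.
have [||J [[idJ J1 Jx] Jmax]] := @noeth_max _ (regmod R)
  [set J | [/\ ideal J, ~ J (1 : R) & J x]] [set y | exists a, y = a * x] noethR.
- by move=> J [].
- split; last by exists 1; rewrite mul1r.
    apply/submoduleP; split=> [|a _ [b ->]|_ _ [a ->] [b ->]].
    + by exists 0; rewrite mul0r.
    + by exists (a * b); rewrite -mulrA.
    + by exists (a + b); rewrite mulrDl.
  by move=> [a ax]; apply: nunit; exists a.
rewrite (uniqI J) //; split=> //; first by move=> JT; apply: J1; rewrite JT.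
move=> K idK JK KT; apply/seteqP; split=> //; apply: Jmax => //; split=> //.
  move=> K1; apply: KT; apply/seteqP; split=> // y _.
  by rewrite -[y]mulr1; apply: (idealM _ idK).
exact: JK.
Qed.

End LocalRings.

(** * Submodules and regular sequences of a localized module *)

Section Localization.
Variables (A : comPzRingType) (p : spec A).
Local Notation cp p := (~` (prime_set p)).
Local Notation Ap := (loc_ring p).
Local Notation fr a s := (@Defs.frac A p (regmod A) a s : loc_ring p).

Lemma ex_den a : cp p a -> exists s : denom p, den s = a.
Proof.
move=> pa; have pa' : a \notin (p : set A) by rewrite notin_setE.
by exists (Sub a pa').
Qed.

Section Modules.
Variable M : lmodType A.
Local Notation Mp := [the lmodType (loc_ring p) of loc p M].

Lemma frac0P (m : M) s : frac m s = (0 : Mp) <-> sat (cp p) [set 0] m.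
Proof.
split=> [/fracP[u]|[a [/ex_den[u <-] am]]].
  rewrite den1 mulr1 scaler0 => um; exists (den u); split=> //; exact: denP.
by apply/fracP; exists u; rewrite den1 mulr1 scaler0.
Qed.

Lemma zero_locP : zero_module (loc p M) <-> sat (cp p) [set (0 : M)] = setT.
Proof.
split=> [M0|MT].
  by apply/seteqP; split=> // m _; apply/(frac0P m (denom1 p))/M0.
by elim/fracW => m s; apply/frac0P; rewrite MT.
Qed.

Definition contract (L : set Mp) : set M := [set m | L (frac m (denom1 p))].

Lemma contractP (L : set Mp) m s : submodule L -> L (frac m s) <-> contract L m.
Proof.
move=> subL; split=> [/(submoduleZ subL (fr (den s) (denom1 p)))|/(submoduleZ subL (fr 1 s))];
  rewrite scalefrac; congr L; apply: frac_congr; rewrite denM den1 ?scalerA.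
  by congr (_ *: _); ring.
by congr (_ *: _); ring.
Qed.

Lemma contract_saturated (L : set Mp) : submodule L -> saturated (cp p) (contract L).
Proof.
move=> subL; split; first (apply/submoduleP; split).
- exact: (submodule0 subL).
- move=> a u Lu; apply/(contractP _ (denomM (denom1 p) (denom1 p)) subL).
  by rewrite -scalefrac; apply: submoduleZ.
- move=> u v Lu Lv; apply/(contractP _ (denomM (denom1 p) (denom1 p)) subL).
  by have := submoduleD subL Lu Lv; rewrite addfrac den1 !scale1r.
move=> a m /ex_den[s <-] /(contractP _ s subL); rewrite /contract /=.
by congr L; apply: frac_congr; rewrite den1 scale1r.
Qed.

Lemma contract_reg (L : set Mp) a s : submodule L -> reg L (fr a s) <-> reg (contract L) a.
Proof.
move=> subL; split=> H.
  move=> m Lam; apply: (H (frac m (denom1 p))).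
  by rewrite scalefrac; apply/contractP.
elim/fracW => m t; rewrite scalefrac => Lam.
by apply/(contractP m t subL)/H/(contractP _ (denomM s t) subL).
Qed.

Lemma contract_ext (L : set Mp) a s : submodule L ->
  contract (ext [set 1] L (fr a s)) = ext (cp p) (contract L) a.
Proof.
move=> subL.
have subfrac (m n : M) t r : (frac m t : Mp) - frac n r =
    frac (den r *: m - den t *: n) (denomM t r).
  by rewrite -scalerN -addfrac; congr (_ + _); exact: loc_oppE.
apply/seteqP; split=> m.
  move=> [_ [m' [-> ]]]; rewrite scale1r; elim/fracW: m' => m' t.
  rewrite scalefrac subfrac => /(contractP _ _ subL) H.
  exists (den (denomM s t)), m'; split; first exact: denP.
  by move: H; rewrite den1 scale1r.
move=> [b [m' [/ex_den[u <-] H]]]; exists 1, (frac (den s *: m') u); split=> //.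
rewrite scale1r scalefrac subfrac; apply/(contractP _ _ subL).
rewrite den1 scale1r denM -scalerA [a *: _]scalerA mulrC -[(den s * a) *: _]scalerA.
rewrite -scalerBr.
apply: submoduleZ => //; exact: (contract_saturated subL).1.
Qed.

(** Denominators are units of the localized ring, so regularity, the submodule [ext] and membership
    in [I] depend on numerators alone. *)
Lemma rs_loc (I : set Ap) (as_ : seq (A * denom p)) (L : set Mp) :
    submodule L -> (forall a s, I (fr a s) <-> prime_set p a) ->
  rs [set 1] I L [seq fr x.1 x.2 | x <- as_] <->
  rs (cp p) p (contract L) [seq x.1 | x <- as_].
Proof.
move=> subL IP; elim: as_ L subL => [|[a s] as_ IH] L subL /=.
  split=> H LT; apply: H; apply/seteqP; split=> //.
    by elim/fracW => m s _; apply/(contractP _ _ subL); rewrite LT.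
  by move=> m _; rewrite LT.
rewrite -(contract_ext _ s) //.
have subE : submodule (ext [set 1] L (fr a s)).
  by apply: ext_submodule => // _ _ -> ->; rewrite mulr1.
by split=> -[/IP Ia /(contract_reg a s subL) ra /IH-/(_ subE) H]; split.
Qed.


End Modules.
End Localization.

(** * Primes, support and depth over the localized ring *)

Section Spectrum.
Variables (A : comPzRingType) (p : spec A).
Local Notation cp p := (~` (prime_set p)).
Local Notation Ap := (loc_ring p).
Local Notation fr a s := (@Defs.frac A p (regmod A) a s : loc_ring p).

Definition pext (P : set A) : set Ap := [set z | exists a s, P a /\ z = fr a s].

(** The bijection of the primes inside [p] with those of the localized ring, kept as a relation
    because [pext P] is proper only for [P] inside [p]. *)
Definition rel_spec (P : spec A) (Q : spec Ap) :=
  forall a s, prime_set Q (fr a s) <-> prime_set P a.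

Lemma pextE (P : spec A) a s : (P : set A) `<=` p -> pext P (fr a s) <-> prime_set P a.
Proof.
move=> Pp; split=> [[b [t [Pb /fracP[u /= ub]]]]|Pa]; last by exists a, s.
have : prime_set P (den u * den t * a).
  by rewrite [_ * a]ub; apply: pM.
have nP (r : denom p) : ~ prime_set P (den r) by move=> /Pp; apply: denP.
by move=> /primeM[/primeM[/nP|/nP]|].
Qed.

Lemma pext_ideal (P : spec A) : ideal (pext P).
Proof.
apply/submoduleP; split=> [|x _ [b [t [Pb ->]]]|_ _ [a [s [Pa ->]]] [b [t [Pb ->]]]].
- by exists 0, (denom1 p); split=> //; exact: (submodule0 (prime_ideal P)).
- elim/fracW: x => a s; exists (a * b), (denomM s t); split; first exact: pM.
  exact: mulfrac.
- exists (den t * a + den s * b), (denomM s t).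
  by split; [apply: (idealD (prime_ideal P)); apply: pM|rewrite addfrac].
Qed.

Lemma frE1 : (1 : Ap) = fr 1 (denom1 p). Proof. by []. Qed.

Lemma ex_pext (P : spec A) : (P : set A) `<=` p -> exists Q, rel_spec P Q.
Proof.
move=> Pp.
have P1 : ~ pext P 1 by rewrite frE1 => /(pextE _ _ Pp); apply: prime_proper.
have PM (x y : Ap) : pext P (x * y) -> pext P x \/ pext P y.
  elim/fracW: x => a s; elim/fracW: y => b t.
  by rewrite mulfrac !pextE // => /primeM.
by exists (Spec (pext_ideal P) P1 PM) => a s; apply: pextE.
Qed.

Lemma ex_pctr (Q : spec Ap) : exists P, rel_spec P Q.
Proof.
have subQ := prime_ideal Q.
pose P : set A := [set a | prime_set Q (fr a (denom1 p))].
have idP : ideal P by apply: (contract_saturated (M := regmod A) subQ).1.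
have P1 : ~ P 1 by rewrite /P /= -frE1; apply: prime_proper.
have PM x y : P (x * y) -> P x \/ P y.
  move=> Pxy; apply: primeM.
  rewrite mulfrac; exact/(contractP (M := regmod A) _ _ subQ).
exists (Spec idP P1 PM) => a s; exact: (contractP (M := regmod A) _ _ subQ).
Qed.

Lemma rel_spec_sub P Q : rel_spec P Q -> (P : set A) `<=` p.
Proof.
move=> PQ a Pa; apply: contrapT => /ex_den[s sa].
apply: (@prime_proper _ Q); have /(PQ _ s) : prime_set P a by [].
by congr (prime_set Q _); apply: frac_congr; rewrite -sa den1 /= !regscaleE mul1r mulr1.
Qed.

Lemma rel_spec_le P Q P' Q' : rel_spec P Q -> rel_spec P' Q' ->
  (P : set A) `<=` P' <-> (Q : set Ap) `<=` Q'.
Proof.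
move=> PQ PQ'; split=> [PP'|QQ' a /(PQ a (denom1 p)) /QQ' /PQ' //].
by elim/fracW => a s /PQ /PP' /PQ'.
Qed.

Lemma rel_spec_lt P Q P' Q' : rel_spec P Q -> rel_spec P' Q' ->
  (P : set A) `<` P' <-> (Q : set Ap) `<` Q'.
Proof.
move=> PQ PQ'; have H := rel_spec_le PQ PQ'; have H' := rel_spec_le PQ' PQ.
by split=> -[h h']; split; [apply/H|move=> /H'|apply/H|move=> /H'].
Qed.

Lemma loc_ring_local : local_ring Ap /\ max_ideal Ap = pext p.
Proof.
apply: max_idealE; first exact: pext_ideal.
  by rewrite frE1 pextE //; exact: prime_proper.
elim/fracW => a s; rewrite pextE // => /ex_den[t <-].
exists (fr (den s) t); rewrite mulfrac frE1; apply: frac_congr.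
by rewrite denM den1 !regscaleE mul1r mulr1 mulrC.
Qed.

Variable M : lmodType A.
Local Notation Mp := [the lmodType (loc_ring p) of loc p M].

(** Localizing [Mp] at [Q] gives the localization of [M] at [P]; only the vanishing of the two is
    compared, by multiplying the numerators of the killing elements. *)
Lemma supp_spec P Q : rel_spec P Q -> supp Mp Q <-> supp M P.
Proof.
move=> PQ; rewrite /supp /= !zero_locP.
suff H : sat (cp Q) [set (0 : Mp)] = setT <-> sat (cp P) [set (0 : M)] = setT.
  by split=> nH; [move=> /H|move=> /H].
have Pp := rel_spec_sub PQ.
split=> HT; apply/seteqP; split=> //.
  move=> m _; have [z [nQz]] : sat (cp Q) [set (0 : Mp)] (frac m (denom1 p)) by rewrite HT.
  elim/fracW: z nQz => a s nQa; rewrite /= scalefrac => /frac0P[b [pb]].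
  rewrite /= scalerA => bam; exists (b * a); split=> //.
  by apply: notin_primeM; [move=> /Pp|move=> /PQ-/(_ s)].
elim/fracW => m s _; have [a [pa am]] : sat (cp P) [set (0 : M)] m by rewrite HT.
exists (fr a (denom1 p)); split; first by move=> /PQ.
rewrite /= scalefrac am; apply/frac0P; exists 1.
by rewrite scaler0; split=> //; exact: notin_prime1.
Qed.

Lemma loc_chain n : (exists c, supp_chain Mp n c) <->
  exists c, supp_chain M n c /\ forall i, (i <= n)%N -> (c i : set A) `<=` p.
Proof.
split=> [[c [cs cc]]|[c [[cs cc] cp]]].
  have /choice[d dP] : forall i, exists P, rel_spec P (c i) by move=> i; apply: ex_pctr.
  exists d; split; last by move=> i _; apply: rel_spec_sub (dP i).
  split=> i lti; first by apply/(supp_spec (dP i))/cs.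
  exact/(rel_spec_lt (dP i) (dP i.+1))/cc.
(* Beyond index [n] the prime [c i] may leave [p], and an arbitrary prime is chosen there. *)
have /choice[d dP] : forall i, exists Q, (i <= n)%N -> rel_spec (c i) Q.
  move=> i; case: (leqP i n) => [/cp/ex_pext[Q PQ]|_]; first by exists Q.
  by have [Q _] := ex_pext (@subset_refl _ (p : set A)); exists Q.
exists d; split=> i lti; first by apply/(supp_spec (dP i lti))/cs.
by apply/(rel_spec_lt (dP i (ltnW lti)) (dP i.+1 lti))/cc.
Qed.

Lemma loc_depth n : (exists xs, [/\ size xs = n,
    forall x, x \in xs -> max_ideal Ap x & regular_seq Mp xs]) <->
  exists xs, size xs = n /\ rs (cp p) p (sat (cp p) [set (0 : M)]) xs.
Proof.
have sub00 := zero_submodule Mp; have [_ mE] := loc_ring_local.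
have IP a s : max_ideal Ap (fr a s) <-> prime_set p a by rewrite mE pextE.
have contract0 : contract [set (0 : Mp)] = sat (cp p) [set (0 : M)].
  by apply/seteqP; split=> m H; apply/(frac0P m (denom1 p)).
split=> [[xs [sz xsm xsr]]|[xs [sz xsr]]].
  pose as_ := [seq (num_of x, den_of x) | x <- xs] : seq (A * denom p).
  have xsE : xs = [seq fr x.1 x.2 | x <- as_].
    by rewrite -map_comp -[LHS]map_id; apply: eq_map => x /=; rewrite num_denK.
  exists [seq x.1 | x <- as_]; split; first by rewrite !size_map.
  rewrite -contract0; apply/(rs_loc as_ sub00 IP); rewrite -xsE; exact/regular_seqP.
pose as_ := [seq (x, denom1 p) | x <- xs].
have xsE : xs = [seq x.1 | x <- as_] by rewrite -map_comp map_id.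
exists [seq fr x.1 x.2 | x <- as_].
have [|? ?] := (regular_seqP Mp (max_ideal Ap) [seq fr x.1 x.2 | x <- as_]).1; last first.
  by split=> //; rewrite !size_map.
by apply/(rs_loc as_ sub00 IP); rewrite -xsE contract0.
Qed.

End Spectrum.

(** * Dimension, depth and defect *)

Section NatSup.
Local Open Scope ereal_scope.
Implicit Types (C D : set nat) (n l : nat).

(** Written exactly as the suprema in [krull_dim] and [depth_in], so that both fold to it. *)
Definition natsup C : \bar int := supremum -oo [set n%:Z%:E | n in C].

(** The bound on [x0] covers the empty set, whose supremum is the default [x0]. *)
Lemma supremum_leP (x0 e : \bar int) (S : set (\bar int)) : x0 <= e ->
  supremum x0 S <= e <-> (forall x, S x -> x <= e).
Proof.
move=> x0e; rewrite /supremum; case: eqP => [->|_]; first by split.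
have [ubS lubS] := xgetPex x0 (supremums_bar_int S).
by split=> [Se x /ubS xS|]; [exact: le_trans Se|exact: lubS].
Qed.

Lemma natsup_eq C D : (forall n, C n <-> D n) -> natsup C = natsup D.
Proof. by move=> CD; congr natsup; apply/seteqP; split=> n /CD. Qed.

Lemma natsup_leP C e : natsup C <= e <-> (forall n, C n -> n%:Z%:E <= e).
Proof.
rewrite /natsup supremum_leP ?leNye//.
by split=> [H n Cn|H _ [n Cn <-]]; apply: H => //; exists n.
Qed.

Lemma natsup_ge C n : C n -> n%:Z%:E <= natsup C.
Proof. by move=> Cn; have /natsup_leP := lexx (natsup C); apply. Qed.

Lemma natsup_cases D d0 : D d0 ->
  (exists d, [/\ D d, natsup D = d%:Z%:E & forall n, D n -> (n <= d)%N]) \/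
  (natsup D = +oo /\ forall n, exists2 d, D d & (n <= d)%N).
Proof.
move=> Dd0; have [[b Db]|unb] := pselect (exists b, forall n, D n -> (n <= b)%N).
  left; have ex : exists n, `[< D n >] by exists d0; apply/asboolP.
  have [|d /asboolP Dd dmax] := ex_maxnP ex (m := b); first by move=> n /asboolP /Db.
  exists d; split=> //; last by move=> n Dn; apply/dmax/asboolP.
  apply/le_anti; rewrite natsup_ge // andbT; apply/natsup_leP => n Dn.
  by rewrite lee_fin lez_nat; apply/dmax/asboolP.
have big n : exists2 d, D d & (n <= d)%N.
  apply: contrapT => H; apply: unb; exists n => d Dd.
  by rewrite leqNgt; apply/negP => /ltnW nd; apply: H; exists d.
right; split=> //; case E : (natsup D) => [z| |] //.
  have [d Dd] := big `|z|%N.+1; have := natsup_ge Dd; rewrite E lee_fin; lia.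
by have := natsup_ge Dd0; rewrite E.
Qed.

(** For nonempty [D] this is sup C <= sup D + l, stated without subtracting infinite values. *)
Definition bounded_defect C D l := forall c, C c -> exists2 d, D d & (c <= d + l)%N.

(* For C and D both unbounded this relies on +oo - +oo = -oo. *)
Lemma natsup_subP C D l d0 : D d0 ->
  natsup C - natsup D <= l%:Z%:E <-> bounded_defect C D l.
Proof.
move=> Dd0; have [[d [Dd -> dmax]]|[-> Dbig]] := natsup_cases Dd0; last first.
  split=> [_ c _|_]; last by case: (natsup C).
  by have [d Dd cd] := Dbig c; exists d => //; lia.
have -> : (natsup C - d%:Z%:E <= l%:Z%:E) <-> natsup C <= (d + l)%N%:Z%:E.
  by case: (natsup C) => [z| |] //=; rewrite !lee_fin; lia.
split=> [/natsup_leP H c /H|H]; first by rewrite lee_fin; exists d => //; lia.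
by apply/natsup_leP => c /H[d' /dmax]; rewrite lee_fin; lia.
Qed.

(** Taking [n] in [C] makes the minimum equal to [n], so the truncated conditions for all [n]
    recover the whole supremum, even an infinite one. *)
Lemma natsup_minP C D l d0 : D d0 ->
  (forall n, mine (natsup C) n%:Z%:E - l%:Z%:E <= natsup D) <-> bounded_defect C D l.
Proof.
move=> Dd0; split=> [H c Cc|H n].
  have := H c; rewrite min_r ?natsup_ge//.
  have [[d [Dd -> dmax]]|[_ Dbig] _] := natsup_cases Dd0.
    by rewrite lee_fin => ?; exists d => //; lia.
  by have [d Dd cd] := Dbig c; exists d => //; lia.
have [[d [Dd -> dmax]]|[-> _]] := natsup_cases Dd0; last by rewrite leey.
have : natsup C <= (d + l)%N%:Z%:E.
  by apply/natsup_leP => c /H[d' /dmax]; rewrite lee_fin; lia.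
have : mine (natsup C) n%:Z%:E <= natsup C by rewrite ge_min lexx.
move=> /le_trans/[apply]; case: (mine _ _) => [z| |] //=; rewrite !lee_fin; lia.
Qed.

End NatSup.

(** * The defect at a prime and its monotonicity *)

Section Main.
Variables (A : comPzRingType) (M : lmodType A).
Local Notation cp p := (~` (prime_set p)).
Local Notation locmod p := [the lmodType (loc_ring p) of loc p M].
Local Notation zero_at p := (sat (cp p) [set (0 : M)]).

Definition chains_below (p : spec A) : set nat := [set n | exists c,
  supp_chain M n c /\ forall i, (i <= n)%N -> (c i : set A) `<=` p].

Definition reg_lengths (p : spec A) : set nat := [set n | exists xs,
  size xs = n /\ rs (cp p) p (zero_at p) xs].

(** The common form of cmd(M_p) <= l and of (C_n^l) at [p] for all [n]. *)
Definition defect_le (p : spec A) (l : nat) :=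
  zero_at p <> setT -> bounded_defect (chains_below p) (reg_lengths p) l.

Lemma reg_lengths0 p : zero_at p <> setT -> reg_lengths p 0.
Proof. by move=> NT; exists [::]. Qed.

Lemma loc_dimE p : krull_dim (locmod p) = natsup (chains_below p).
Proof.
by rewrite /krull_dim -!/(natsup _); apply: natsup_eq => n; exact: loc_chain.
Qed.

Lemma loc_depthE p : zero_at p <> setT ->
  depth (locmod p) = natsup (reg_lengths p).
Proof.
move=> NT; have nz : ~ zero_module (loc p M) by rewrite zero_locP.
rewrite /depth /depth_in (asboolF nz).
by rewrite -!/(natsup _); apply: natsup_eq => n; exact: loc_depth.
Qed.

Lemma cmd_loc_leP p l : (cmd_local (locmod p) <= l%:Z%:E)%E <-> defect_le p l.
Proof.
rewrite /cmd_local; case: asboolP => [/zero_locP MT|].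
  by rewrite lee_fin; split=> // _ /(_ MT).
rewrite zero_locP => NT.
rewrite loc_dimE loc_depthE // (natsup_subP _ _ (reg_lengths0 NT)).
by split=> [H _|H]; [exact: H|exact: H].
Qed.

Lemma propC_loc_leP l :
  (forall n, propC M n l) <-> forall p, defect_le p l.
Proof.
split=> [H p NT|H n p].
  apply/(natsup_minP _ _ (reg_lengths0 NT)) => n; rewrite -loc_dimE -loc_depthE //.
  exact: H.
have [MT|NT] := pselect (zero_at p = setT).
  by rewrite /depth /depth_in asboolT ?leey//; apply/zero_locP.
have := H p NT; rewrite -(natsup_minP _ _ (reg_lengths0 NT)).
by rewrite -loc_dimE -loc_depthE // => /(_ n).
Qed.

Lemma zero_at_le (p q : spec A) : (p : set A) `<=` q -> zero_at q = setT ->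
  zero_at p = setT.
Proof.
move=> pq qT; apply/seteqP; split=> // m _.
have [s [qs sm]] : zero_at q m by rewrite qT.
by exists s; split=> // /pq.
Qed.

(** With [D] the depth at [q], a chain of length [n] inside [p] extends to one of length
    [n + (D - size ys)] inside [q]. The defect at [q] bounds this by [D + l], whence
    [n <= size ys + l]. *)
Lemma defect_le_sub (p q : spec A) l : noeth_module (regmod A) -> noeth_module M ->
  (p : set A) `<=` q -> defect_le q l -> defect_le p l.
Proof.
move=> noethA noethM pq Hq NT n [c [[csupp cc] cp]].
have NTq : zero_at q <> setT by move=> /(zero_at_le pq).
(* [localized_depth] with both primes equal to [q] bounds the lengths: a chain starting above [q]
   and staying inside [q] has no strict step. *)
have Dmax : exists D, reg_lengths q D /\ forall n, reg_lengths q n -> (n <= D)%N.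
  have [ys [_ ysP]] := localized_depth noethA noethM (@subset_refl _ (q : set A)) NTq.
  have bnd k : reg_lengths q k -> (k <= size ys)%N.
    move=> [xs [<- /ysP[c' [qc cc' c'q]]]].
    rewrite leqNgt -subn_gt0; apply/negP => /[dup] lt /cc'[_]; apply.
    by apply: subset_trans qc; apply: c'q.
  have ex : exists k, `[< reg_lengths q k >] by exists 0%N; apply/asboolP/reg_lengths0.
  have [|D /asboolP Dd dmax] := ex_maxnP ex (m := size ys).
    by move=> k /asboolP /bnd.
  by exists D; split=> // k kD; apply/dmax/asboolP.
have [D [[xs [szxs rxs]] Dle]] := Dmax.
have [ys [rys ysP]] := localized_depth noethA noethM pq NT.
exists (size ys); first by exists ys.
have [c' [pc' cc' c'q]] := ysP xs rxs; rewrite szxs in cc' c'q.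
set k := (D - size ys)%N in cc' c'q.
have pc'i i : (i <= k)%N -> (p : set A) `<=` c' i.
  elim: i => // i IH lt; apply: subset_trans (IH (ltnW lt)) _.
  by have [] := cc' i lt.
suff /Hq-/(_ NTq)[d /Dle] : chains_below q (n + k)%N by rewrite /k; lia.
(* The prime [c n] is replaced by [c' 0], which contains [p] and hence [c n]; the step from
   [c (n - 1)] stays strict and no length is lost. The upper primes contain [p], so they remain in
   the support. *)
exists (fun i => if (i < n)%N then c i else c' (i - n)%N); split.
  split=> i le.
    case: ltnP => [/ltnW/csupp //|ni].
    rewrite /supp /= zero_locP => /(zero_at_le (pc'i (i - n)%N _)) H.
    by apply/NT/H; lia.
  case: (ltnP i.+1 n) => [lt1|ge1]; first by rewrite (ltnW lt1); apply: cc; lia.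
  case: ltnP => [lt2|ge2]; last by rewrite subSn //; apply: cc'; lia.
  have -> : (i.+1 - n = 0)%N by lia.
  have [ci nci] := cc i lt2; have nE : n = i.+1 by lia.
  have cp' : (c i.+1 : set A) `<=` c' 0%N by apply: subset_trans pc'; apply: cp; lia.
  split; first exact: subset_trans cp'.
  by move=> c'c; apply: nci; apply: subset_trans c'c.
move=> i le; case: ltnP => [lt|ge]; last by apply: c'q; lia.
by apply: subset_trans pq; apply: cp; lia.
Qed.

(** Elements outside [m] are units, so saturation at [m] changes nothing and [M] has the same
    dimension and depth as its localization at [m]. *)
Lemma cmd_local_leP (m : spec A) l : max_ideal A = m ->
    (forall x, ~ prime_set m x -> exists y, y * x = 1) ->
  (cmd_local M <= l%:Z%:E)%E <-> defect_le m l.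
Proof.
move=> mE unitP; have sub00 := zero_submodule M.
have le_m (P : spec A) : (P : set A) `<=` m.
  move=> x Px; apply: contrapT => /unitP[y yx].
  by apply: (@prime_proper _ P); rewrite -yx; apply: pM.
have satE (N : set M) : submodule N -> sat (cp m) N = N.
  move=> subN; apply/seteqP; split=> [u [s [/unitP[y ys] Nu]]|u Nu].
    by rewrite -[u]scale1r -ys -scalerA; apply: submoduleZ.
  by exists 1; rewrite scale1r; split=> //; exact: notin_prime1.
have extE (N : set M) x : submodule N -> ext (cp m) N x = ext [set 1] N x.
  move=> subN; apply/seteqP; split=> u.
    move=> [s [u' [/unitP[y ys] Nu]]]; exists 1, (y *: u'); split=> //.
    rewrite -ys -scalerA [x *: _]scalerA mulrC -scalerA; exact: modZ.
  by move=> [_ [u' [-> Nu]]]; exists 1, u'; split=> //; exact: notin_prime1.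
have rsE (N : set M) xs : submodule N -> rs (cp m) m N xs <-> rs [set 1] m N xs.
  elim: xs N => //= x xs IH N subN.
  have subE : submodule (ext [set 1] N x).
    by rewrite -extE //; apply: (ext_saturated m x subN).1.
  by rewrite extE //; split=> -[mx rx /IH-/(_ subE) H]; split.
have zeroE : zero_module M <-> zero_at m = setT.
  rewrite satE //; split=> [M0|MT u]; first by apply/seteqP; split=> // u _; apply: M0.
  by have : [set (0 : M)] u by rewrite MT.
have dimE : krull_dim M = natsup (chains_below m).
  rewrite /krull_dim -!/(natsup _); apply: natsup_eq => n.
  by split=> [[c cc]|[c [cc _]]]; exists c.
have depE : ~ zero_module M -> depth M = natsup (reg_lengths m).
  move=> NT; rewrite /depth /depth_in asboolF //.
  rewrite -!/(natsup _); apply: natsup_eq => n.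
  rewrite /reg_lengths /= satE // mE; split.
    by move=> [xs [sz xsm xsr]]; exists xs; split=> //; apply/rsE/regular_seqP.
  by move=> [xs [sz /(rsE _ _ sub00)/regular_seqP[]]]; exists xs.
rewrite /cmd_local; case: asboolP => [/zeroE MT|NT].
  by rewrite lee_fin; split=> // _ /(_ MT).
rewrite dimE depE //.
have NT' : zero_at m <> setT by move=> /zeroE.
rewrite (natsup_subP _ _ (reg_lengths0 NT')).
by split=> [H _|H]; [exact: H|exact: H].
Qed.

End Main.

Theorem theorem4p5 (A : comPzRingType) (M : lmodType A) (l : nat)
    (noethA : noetherian A) (fgM : fg_module M) :
  (cmd M <= (l%:Z)%:E)%E <-> (forall n : nat, propC M n l).
Proof.
have noethM := noeth_fg noethA fgM.
rewrite propC_loc_leP /cmd; case: asboolP => [localA|_].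
  have [idm m1 unitP] := local_max_ideal noethA localA.
  have mM x y : max_ideal A (x * y) -> max_ideal A x \/ max_ideal A y.
    move=> mxy; have [mx|/unitP[z zx]] := pselect (max_ideal A x); first by left.
    by right; rewrite -[y]mul1r -zx -mulrA; apply: (idealM _ idm).
  pose m := Spec idm m1 mM.
  rewrite (@cmd_local_leP A M m) //.
  (* Here the left side only concerns [m]; every prime lies in [m], so monotonicity of the defect
     gives the other primes. *)
  split=> [Hm p|]; last exact.
  apply: (defect_le_sub noethA noethM _ Hm) => x px; apply: contrapT => /unitP[y yx].
  by apply: (@prime_proper _ p); rewrite -yx; apply: pM.
(* Without a unique maximal ideal the supremum runs over all primes and the conditions agree prime
   by prime; the default [0] for the zero ring is at most [l]. *)
rewrite supremum_leP ?lee_fin //; split=> [H p|H _ [p _ <-]]; last exact/cmd_loc_leP.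
by apply/cmd_loc_leP/H; exists p.
Qed.
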